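(* For every $(K_1,K_2)$ discrete memoryless MAC-IC-MAC with capacity region $\mathcal{C}$, $$\mathcal{R}_{\mathrm{c}}=\mathcal{R}_{\mathrm{in}}\subseteq\mathcal{C},$$ where $\mathcal{R}_{\mathrm{in}}=\bigcup_{P_{\mathrm{in}}\in\mathcal{P}_{\mathrm{in}}}\mathcal{R}_{\mathrm{in}}(P_{\mathrm{in}})$ and $\mathcal{R}_{\mathrm{c}}=\bigcup_{P_{\mathrm{in}}\in\mathcal{P}_{\mathrm{in}}}\mathcal{R}_{\mathrm{c}}(P_{\mathrm{in}})$.
   Context: **Indices.** $K_1,K_2\ge 1$ are integers. For $i\in\{1,2\}$, $i'$ denotes the other element of $\{1,2\}$, and $\varTheta_i=\{i.1,\dots,i.K_i\}$ is the set of labels of the users of cell $i$. $\varUpsilon_i$ always denotes a subset of $\varTheta_i$ containing $i.1$; $\varOmega_i$ always denotes a non-empty subset of $\varTheta_i$; $\bar{\varUpsilon}_i,\bar{\varOmega}_i$ are complements in $\varTheta_i$. For $S\subseteq\varTheta_i$, $X_S=(X_{i.j})_{i.j\in S}$, and for a rate tuple write $R(S)=\sum_{i.j\in S}R_{i.j}$. **Channel.** A $(K_1,K_2)$ discrete memoryless (DM) MAC-IC-MAC has $K_1+K_2$ transmitters Tx$i.j$ with discrete input alphabets $\mathcal{X}_{i.j}$, two receivers Rx$i$ with discrete output alphabets $\mathcal{Y}_i$, and transition law $$p(y_1^n,y_2^n|x_{\varTheta_1}^n,x_{\varTheta_2}^n)=\prod_{t=1}^n p(y_{1t}|x_{\varTheta_1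 t},x_{2.1t})\,p(y_{2t}|x_{\varTheta_2 t},x_{1.1t}).$$ Tx$i.j$ encodes a message $M_{i.j}$, uniform on $\{1,\dots,2^{nR_{i.j}}\}$ (messages independent), into $x_{i.j}^n(M_{i.j})$; Rx$i$ produces an estimate $\hat M_{\varTheta_i}$ of $M_{\varTheta_i}$ from $Y_i^n$. The error probability is $P_e^{(n)}=P\{\hat M_{\varTheta_1}\ne M_{\varTheta_1}\text{ or }\hat M_{\varTheta_2}\neq M_{\varTheta_2}\}$. A tuple $(R_{\varTheta_1},R_{\varTheta_2})\in\mathbb{R}_+^{K_1+K_2}$ is achievable if there are codes of these rates with $P_e^{(n)}\to0$ as $n\to\infty$; the capacity region $\mathcal{C}$ is the closure of the set of achievable tuples. **Coding distributions.** $\mathcal{P}_{\mathrm{in}}$ is the set of joint distributions of discrete random variables $(Q,U_1,X_{\varTheta_1},U_2,X_{\varTheta_2})$ that factor as $$p(q)\,p(u_1,x_{1.1}|q)\prod_{j=2}^{K_1}p(x_{1.j}|q)\;p(u_2,x_{2.1}|q)\prod_{j=2}^{K_2}p(x_{2.j}|q).$$ The outputs $(Y_1,Y_2)$ are generated from $(X_{\varTheta_1},X_{\varTheta_2})$ by the channel (independently of $Q,U_1,U_2$ given the inputs). **Set functions.** Given $P_{\mathrm{in}}$, $$\mathsf{A}_{\varUpsilon_i}=I(X_{\varUpsilon_i};Y_i|X_{\bar\varUpsilon_i},U_i,U_{i'},Q),\qquad \mathsf{B}_{\varOmega_i}=I(X_{\varOmega_i};Y_i|X_{\bar\varOmega_i},U_{i'},Q),$$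 $$\mathsf{E}_{\varUpsilon_i}=I(X_{\varUpsilon_i},U_{i'};Y_i|X_{\bar\varUpsilon_i},U_i,Q),\qquad \mathsf{G}_{\varOmega_i}=I(X_{\varOmega_i},U_{i'};Y_i|X_{\bar\varOmega_i},Q).$$ **Regions.** $\mathcal{R}_{\mathrm{in}}(P_{\mathrm{in}})$ is the set of $(R_{\varTheta_1},R_{\varTheta_2})\in\mathbb{R}_+^{K_1+K_2}$ such that for all admissible $\varUpsilon_1,\varOmega_1,\varUpsilon_2,\varOmega_2$: 1. $R(\varOmega_1)\le\mathsf{B}_{\varOmega_1}$ 2. $R(\varUpsilon_1)\le\mathsf{A}_{\varUpsilon_1}+\mathsf{E}_{\varUpsilon_2}$ 3. $R(\varOmega_2)\le\mathsf{B}_{\varOmega_2}$ 4. $R(\varUpsilon_2)\le\mathsf{E}_{\varUpsilon_1}+\mathsf{A}_{\varUpsilon_2}$ 5. $R(\varUpsilon_1)+R(\varOmega_2)\le\mathsf{A}_{\varUpsilon_1}+\mathsf{G}_{\varOmega_2}$ 6. $R(\varOmega_1)+R(\varUpsilon_2)\le\mathsf{G}_{\varOmega_1}+\mathsf{A}_{\varUpsilon_2}$ 7. $R(\varUpsilon_1)+R(\varUpsilon_2)\le\mathsf{E}_{\varUpsilon_1}+\mathsf{E}_{\varUpsilon_2}$ 8. $R(\varUpsilon_1)+R(\varOmega_1)+R(\varUpsilon_2)\le\mathsf{A}_{\varUpsilon_1}+\mathsf{G}_{\varOmega_1}+\mathsf{E}_{\varUpsilon_2}$ 9. $R(\varUpsilon_1)+R(\varUpsilon_2)+R(\varOmega_2)\le\mathsf{E}_{\varUpsilon_1}+\mathsf{A}_{\varUpsilon_2}+\mathsf{G}_{\varOmega_2}$.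 $\mathcal{R}_{\mathrm{c}}(P_{\mathrm{in}})$ is the set of $(R_{\varTheta_1},R_{\varTheta_2})\in\mathbb{R}_+^{K_1+K_2}$ satisfying the inequalities 1, 3, 5, 6, 7, 8, 9 for all admissible $\varUpsilon_1,\varOmega_1,\varUpsilon_2,\varOmega_2$ (i.e. inequalities 2 and 4 are dropped). *)

(* Defs.v *)
From HB Require Import structures.
From mathcomp Require Import all_boot all_order all_algebra.
From mathcomp Require Import boolp classical_sets reals topology normedtype.
From mathcomp Require Import sequences exp.

Set Implicit Arguments.
Unset Strict Implicit.
Unset Printing Implicit Defensive.

Import Order.TTheory GRing.Theory Num.Theory.
Import numFieldNormedType.Exports.

Local Open Scope classical_set_scope.
Local Open Scope ring_scope.

(* Discrete alphabets (of the channel as well as of the auxiliary variables)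
   are finite. The cells are indexed by bool, so that i' is ~~ i.              *)
Notation cell := bool (only parsing).
Notation cell1 := false (only parsing).
Notation cell2 := true (only parsing).

Definition log2 (R : realType) (x : R) : R := ln x / ln 2.

Definition is_pmf (R : realType) (T : finType) (p : T -> R) : Prop :=
  (forall x, 0 <= p x) /\ \sum_x p x = 1.

Definition prob (R : realType) (W : finType) (P : W -> R) (E : pred W) : R :=
  \sum_(w | E w) P w.

(* I(A; B | C) in bits, for random variables A, B, C on the finite probability
   space (W, P). A term with P[A = a, B = b, C = c] = 0 vanishes because of its
   first factor, and otherwise all the probabilities in it are positive.       *)
Definition cond_mutual_info (R : realType) (W TA TB TC : finType) (P : W -> R)
    (A : W -> TA) (B : W -> TB) (C : W -> TC) : R :=
  \sum_a \sum_b \sum_c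
    let pabc := prob P (fun w => [&& A w == a, B w == b & C w == c]) in
    let pac := prob P (fun w => (A w == a) && (C w == c)) in
    let pbc := prob P (fun w => (B w == b) && (C w == c)) in
    let pc := prob P (fun w => C w == c) in
    pabc * log2 (pabc * pc / (pac * pbc)).

(* User i.j is represented by j.-1 : 'I_(K i); in particular i.1 has index 0.
   [law i x x' y] is p(y_i | x_{Theta_i}, x_{i'.1}).                           *)
Record mac_ic_mac (R : realType) := MacIcMac {
  K : cell -> nat;
  K_gt0 : forall i, (0 < K i)%N;
  inp : forall i, 'I_(K i) -> finType;
  out : cell -> finType;
  law : forall i, {dffun forall j : 'I_(K i), inp j} ->
          inp (Ordinal (K_gt0 (~~ i))) -> out i -> R;
  law_pmf : forall i x x', is_pmf (@law i x x')
}.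
Arguments K {R} _ _.
Arguments K_gt0 {R} _ _.
Arguments inp {R} _ _ _.
Arguments out {R} _ _.
Arguments law {R} _ _ _ _ _.

Definition user1 (R : realType) (ch : mac_ic_mac R) (i : cell) : 'I_(K ch i) :=
  Ordinal (K_gt0 ch i).

Definition cell_inputs (R : realType) (ch : mac_ic_mac R) (i : cell) : finType :=
  {dffun forall j : 'I_(K ch i), inp ch i j}.

Definition inputs (R : realType) (ch : mac_ic_mac R) : finType :=
  {dffun forall i : cell, cell_inputs ch i}.

Definition outputs (R : realType) (ch : mac_ic_mac R) : finType :=
  {dffun forall i : cell, out ch i}.

Definition channel_law (R : realType) (ch : mac_ic_mac R)
    (x : inputs ch) (y : outputs ch) : R :=
  \prod_(i : cell) law ch i (x i) (x (~~ i) (user1 ch (~~ i))) (y i).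

Definition rates (R : realType) (ch : mac_ic_mac R) : Type :=
  ('rV[R]_(K ch cell1) * 'rV[R]_(K ch cell2))%type.

Definition rate (R : realType) (ch : mac_ic_mac R) (r : rates ch) (i : cell) :
    'I_(K ch i) -> R :=
  match i with
  | cell1 => fun j => r.1 ord0 j
  | cell2 => fun j => r.2 ord0 j
  end.

Definition sum_rate (R : realType) (ch : mac_ic_mac R) (r : rates ch) (i : cell)
    (S : {set 'I_(K ch i)}) : R :=
  \sum_(j in S) rate r j.

Definition nonneg_rates (R : realType) (ch : mac_ic_mac R) (r : rates ch) : Prop :=
  forall i (j : 'I_(K ch i)), 0 <= rate r j.

(* The number of integers in {1, ..., 2^(n r)}.                                *)
Definition nb_messages (R : realType) (n : nat) (r : R) : nat :=
  Num.truncn (2 `^ (n%:R * r)).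

Definition cell_messages (R : realType) (ch : mac_ic_mac R) (n : nat)
    (r : rates ch) (i : cell) : finType :=
  {dffun forall j : 'I_(K ch i), 'I_(nb_messages n (rate r j))}.

Definition messages (R : realType) (ch : mac_ic_mac R) (n : nat)
    (r : rates ch) : finType :=
  {dffun forall i : cell, cell_messages n r i}.

Definition output_blocks (R : realType) (ch : mac_ic_mac R) (n : nat) : finType :=
  {dffun forall i : cell, {ffun 'I_n -> out ch i}}.

Record code (R : realType) (ch : mac_ic_mac R) (n : nat) (r : rates ch) := Code {
  enc : forall i (j : 'I_(K ch i)),
          'I_(nb_messages n (rate r j)) -> 'I_n -> inp ch i j;
  dec : forall i, {ffun 'I_n -> out ch i} -> cell_messages n r i
}.

Definition sent (R : realType) (ch : mac_ic_mac R) (n : nat) (r : rates ch)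
    (c : code n r) (m : messages n r) (t : 'I_n) : inputs ch :=
  [ffun i => [ffun j => enc c (m i j) t]].

Definition received (R : realType) (ch : mac_ic_mac R) (n : nat)
    (y : output_blocks ch n) (t : 'I_n) : outputs ch :=
  [ffun i => y i t].

Definition error_prob (R : realType) (ch : mac_ic_mac R) (n : nat) (r : rates ch)
    (c : code n r) : R :=
  (#|messages n r|%:R)^-1 *
  \sum_(m : messages n r)
    \sum_(y : output_blocks ch n | [exists i : cell, dec c (y i) != m i])
      \prod_(t < n) channel_law (sent c m t) (received y t).

Definition achievable (R : realType) (ch : mac_ic_mac R) (r : rates ch) : Prop :=
  nonneg_rates r /\
  exists c : forall n, code n r, (fun n => error_prob (c n)) @ \oo --> (0 : R).

Definition capacity_region (R : realType) (ch : mac_ic_mac R) : set (rates ch) :=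
  closure ([set r | achievable r] :
    set ('rV[R]_(K ch cell1) * 'rV[R]_(K ch cell2))%type).

Definition aux (U : cell -> finType) : finType := {dffun forall i : cell, U i}.

(* The conditional pmfs are kernels given for every q; where pQ q = 0 their
   choice has no effect on P. The factor pX i j is unused for j = user1.       *)
Definition coding_dist (R : realType) (ch : mac_ic_mac R)
    (Q : finType) (U : cell -> finType)
    (P : Q * aux U * inputs ch -> R) : Prop :=
  exists (pQ : Q -> R)
         (pUX : forall i, Q -> U i * inp ch i (user1 ch i) -> R)
         (pX : forall i (j : 'I_(K ch i)), Q -> inp ch i j -> R),
    [/\ is_pmf pQ,
        forall i q, is_pmf (pUX i q),
        forall i (j : 'I_(K ch i)) q, j != user1 ch i -> is_pmf (pX i j q) &
        forall q u x, P (q, u, x) =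
          pQ q * \prod_(i : cell)
            (pUX i q (u i, x i (user1 ch i)) *
             \prod_(j | j != user1 ch i) pX i j q (x i j))].

(* The space on which (Q, U_1, U_2, X_{Theta_1}, X_{Theta_2}, Y_1, Y_2) lives. *)
Definition space (R : realType) (ch : mac_ic_mac R)
    (Q : finType) (U : cell -> finType) : finType :=
  (Q * aux U * inputs ch * outputs ch)%type.

Definition joint_law (R : realType) (ch : mac_ic_mac R)
    (Q : finType) (U : cell -> finType) (P : Q * aux U * inputs ch -> R)
    (w : space ch Q U) : R :=
  P w.1 * channel_law w.1.2 w.2.

Section RandomVariables.
Context (R : realType) (ch : mac_ic_mac R) (Q : finType) (U : cell -> finType).

Definition rvQ (w : space ch Q U) : Q := w.1.1.1.
Definition rvU (i : cell) (w : space ch Q U) : U i := w.1.1.2 i.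
Definition rvX (i : cell) (S : {set 'I_(K ch i)}) (w : space ch Q U) :
    {dffun forall j : {j : 'I_(K ch i) | j \in S}, inp ch i (val j)} :=
  [ffun j => w.1.2 i (val j)].
Definition rvY (i : cell) (w : space ch Q U) : out ch i := w.2 i.

End RandomVariables.

Section SetFunctions.
Context (R : realType) (ch : mac_ic_mac R) (Q : finType) (U : cell -> finType).
Context (P : Q * aux U * inputs ch -> R).

Definition fA (i : cell) (S : {set 'I_(K ch i)}) : R :=
  cond_mutual_info (joint_law P) (rvX S) (@rvY _ ch Q U i)
    (fun w => (rvX (~: S) w, rvU i w, rvU (~~ i) w, rvQ w)).

Definition fB (i : cell) (S : {set 'I_(K ch i)}) : R :=
  cond_mutual_info (joint_law P) (rvX S) (@rvY _ ch Q U i)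
    (fun w => (rvX (~: S) w, rvU (~~ i) w, rvQ w)).

Definition fE (i : cell) (S : {set 'I_(K ch i)}) : R :=
  cond_mutual_info (joint_law P)
    (fun w => (rvX S w, rvU (~~ i) w)) (@rvY _ ch Q U i)
    (fun w => (rvX (~: S) w, rvU i w, rvQ w)).

Definition fG (i : cell) (S : {set 'I_(K ch i)}) : R :=
  cond_mutual_info (joint_law P)
    (fun w => (rvX S w, rvU (~~ i) w)) (@rvY _ ch Q U i)
    (fun w => (rvX (~: S) w, rvQ w)).

Definition Rin_of : set (rates ch) :=
  [set r | nonneg_rates r /\
    forall (S1 O1 : {set 'I_(K ch cell1)}) (S2 O2 : {set 'I_(K ch cell2)}),
    user1 ch cell1 \in S1 -> O1 != finset.set0 ->
    user1 ch cell2 \in S2 -> O2 != finset.set0 ->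
    sum_rate r O1 <= fB O1 /\
    sum_rate r S1 <= fA S1 + fE S2 /\
    sum_rate r O2 <= fB O2 /\
    sum_rate r S2 <= fE S1 + fA S2 /\
    sum_rate r S1 + sum_rate r O2 <= fA S1 + fG O2 /\
    sum_rate r O1 + sum_rate r S2 <= fG O1 + fA S2 /\
    sum_rate r S1 + sum_rate r S2 <= fE S1 + fE S2 /\
    sum_rate r S1 + sum_rate r O1 + sum_rate r S2 <= fA S1 + fG O1 + fE S2 /\
    sum_rate r S1 + sum_rate r S2 + sum_rate r O2 <= fE S1 + fA S2 + fG O2].

Definition Rc_of : set (rates ch) :=
  [set r | nonneg_rates r /\
    forall (S1 O1 : {set 'I_(K ch cell1)}) (S2 O2 : {set 'I_(K ch cell2)}),
    user1 ch cell1 \in S1 -> O1 != finset.set0 ->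
    user1 ch cell2 \in S2 -> O2 != finset.set0 ->
    sum_rate r O1 <= fB O1 /\
    sum_rate r O2 <= fB O2 /\
    sum_rate r S1 + sum_rate r O2 <= fA S1 + fG O2 /\
    sum_rate r O1 + sum_rate r S2 <= fG O1 + fA S2 /\
    sum_rate r S1 + sum_rate r S2 <= fE S1 + fE S2 /\
    sum_rate r S1 + sum_rate r O1 + sum_rate r S2 <= fA S1 + fG O1 + fE S2 /\
    sum_rate r S1 + sum_rate r S2 + sum_rate r O2 <= fE S1 + fA S2 + fG O2].

End SetFunctions.

Definition Rin (R : realType) (ch : mac_ic_mac R) : set (rates ch) :=
  [set r | exists (Q : finType) (U : cell -> finType)
                  (P : Q * aux U * inputs ch -> R),
             coding_dist P /\ Rin_of P r].

Definition Rc (R : realType) (ch : mac_ic_mac R) : set (rates ch) :=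
  [set r | exists (Q : finType) (U : cell -> finType)
                  (P : Q * aux U * inputs ch -> R),
             coding_dist P /\ Rc_of P r].

Arguments capacity_region {R} ch _.
Arguments Rin {R} ch _.
Arguments Rc {R} ch _.

(* Main.v *)
Require Import Defs.
From mathcomp Require Import all_boot all_order all_algebra.
From mathcomp Require Import boolp classical_sets reals topology normedtype.
From mathcomp Require Import sequences exp.
From mathcomp Require Import ring lra.

(* Proof idea. Since Y_i is independent of U_i given X_{i.1}, U_{i'} and Q, all
   four set functions are differences of conditional entropies of Y_i, with the
   same subtracted term h_i = H(Y_i | X_{Theta_i}, U_{i'}, Q).

   If a rate tuple of R_c(P) violates inequality 2, say for the cell i, then
   inequalities 5 and 8 together with the violated one show that it satisfies
   all the inequalities for the distribution in which U_i is made constant.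

   For achievability, user i.1 splits its message into a common part of rate t_i,
   carried by U_i, and a private part superposed on it; receiver i decodes the
   messages of its cell and, non-uniquely, the common part of the other cell.
   The inequalities of R_in(P) are what is left of the rate constraints of this
   scheme after Fourier-Motzkin elimination of t_1 and t_2. To analyse random
   coding, every letter of a codeword is represented as an independent random
   function of the letters which its law depends on: then the letters of the
   sent and of a competing codeword tuple are independent wherever their indices
   differ. A receiver accepts a candidate that passes a likelihood ratio test for
   each error pattern: the sent tuple passes by Chebyshev's inequality, a wrong
   one does not by Markov's, as its likelihood ratio has expectation at most 1.
   Scaling a tuple of R_in(P) by 1 - d makes all the constraints strict. *)

Set Implicit Arguments.
Unset Strict Implicit.
Unset Printing Implicit Defensive.

Import Order.TTheory GRing.Theory Num.Theory.
Import numFieldNormedType.Exports.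

Local Open Scope classical_set_scope.
Local Open Scope ring_scope.

(** * Random codebooks *)

(** The dependent version of distributing a product over sums; the sum is transported to [fprod],
    whose elements are families of tagged values. *)
Lemma big_dffun_distr (R : comPzSemiRingType) (I : finType) (T : I -> finType)
    (F : forall i, T i -> R) :
  \sum_(f : {dffun forall i, T i}) \prod_i F i (f i) = \prod_i \sum_x F i x.
Proof.
rewrite (reindex (@dffun_of_fprod _ T)); last exact/onW_bij/dffun_of_fprod_bij.
transitivity (\sum_(t : fprod T) \prod_(i in I) [ffun x => F i x] (t i)).
  by apply: eq_bigr => t _; apply: eq_bigr => i _; rewrite !ffunE.
rewrite (@big_fprod R 0 1 *%R +%R I T (fun i => [ffun x => F i x])).
rewrite -[LHS]/(\sum_(g in family (fun i => tagged_with T i))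
  \prod_i untag 0 [ffun x => F i x] (g i)).
rewrite -(bigA_distr_big_dep (fun i => tagged_with T i)
  (fun i => untag 0 [ffun x => F i x])).
apply: eq_bigr => i _; rewrite -(big_tag (fun i => [ffun x => F i x])) /=.
by apply: eq_bigr => x _; rewrite ffunE.
Qed.

Section PairLaw.
Context (R : comPzSemiRingType) (V : finType) (Al Ix : V -> finType).
Context (pk : forall k, Al k -> R).
Hypothesis pk1 : forall k, \sum_(x : Al k) pk x = 1.

(** At one time instant, [vec] holds one symbol per virtual user, and [letter] holds the whole
    codebook, that is, one symbol for every index of every user. *)
Definition vec : finType := {dffun forall k, Al k}.
Definition letter : finType := {dffun forall k, {ffun Ix k -> Al k}}.
Definition idx : finType := {dffun forall k, Ix k}.

Definition pv (v : vec) : R := \prod_k pk (v k).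
Definition lam (l : letter) : R := \prod_k \prod_a pk (l k a).
Definition pick_word (l : letter) (w : idx) : vec := [ffun k => l k (w k)].
Definition mix (T : pred V) (v v' : vec) : vec :=
  [ffun k => if T k then v' k else v k].

Lemma sum_pv : \sum_v pv v = 1.
Proof. by rewrite big_dffun_distr big1. Qed.

Lemma sum_lam : \sum_l lam l = 1.
Proof.
rewrite (big_dffun_distr (fun k (g : {ffun Ix k -> Al k}) => \prod_a pk (g a))).
by rewrite big1 // => k _; rewrite -(bigA_distr_bigA (fun=> @pk k)) big1.
Qed.

Lemma natr_forall (J : finType) (P : pred J) :
  ([forall k, P k])%:R = \prod_k (P k)%:R :> R.
Proof.
case: forallP => [h|/forallP]; first by rewrite big1 // => k _; rewrite h.
by rewrite negb_forall => /existsP [k /negbTE h]; rewrite (bigD1 k) //= h mul0r.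
Qed.

Lemma dffun_eqE (J : finType) (T : J -> finType) (f g : {dffun forall k, T k}) :
  (f == g) = [forall k, f k == g k].
Proof.
apply/eqP/forallP => [-> //|h]; apply/ffunP => k; exact/eqP.
Qed.

Lemma sum_delta (J : finType) (F : J -> R) (j : J) :
  \sum_i F i * (i == j)%:R = F j.
Proof.
rewrite (bigD1 j) //= eqxx mulr1 big1 ?addr0 // => i /negbTE ->.
by rewrite mulr0.
Qed.

(** Each indicator is absorbed into the factor of its own index, and the other factors sum to 1. If
    the two indices agree, both indicators fall on the same factor. *)
Lemma pair_letter_law k (w w' : Ix k) (a b : Al k) :
  \sum_(g : {ffun Ix k -> Al k})
     (\prod_x pk (g x)) * ((g w == a)%:R * (g w' == b)%:R) =
  if w != w' then pk a * pk b else pk a * (a == b)%:R.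
Proof.
pose G x z := pk z * ((if x == w then (z == a)%:R else 1) *
                      (if x == w' then (z == b)%:R else 1)).
transitivity (\sum_(g : {ffun Ix k -> Al k}) \prod_x G x (g x)).
  apply: eq_bigr => g _; rewrite /G !big_split /=; congr (_ * (_ * _)).
    by rewrite (bigD1 w) //= eqxx big1 ?mulr1 // => x /negbTE ->.
  by rewrite (bigD1 w') //= eqxx big1 ?mulr1 // => x /negbTE ->.
rewrite -bigA_distr_bigA /G (bigD1 w) //= eqxx.
case: (eqVneq w w') => [<-|ne] /=.
  rewrite [X in _ * X]big1 ?mulr1; last first.
    by move=> x /negbTE ->; rewrite -[RHS](pk1 k); apply: eq_bigr => z _; rewrite !mulr1.
  under eq_bigr do rewrite mulrCA mulrA mulrC mulrA.
  rewrite -(sum_delta (fun z => pk z * (z == b)%:R) a).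
  by apply: eq_bigr => z _; rewrite mulrC mulrA.
have ne' : w' != w by rewrite eq_sym.
rewrite (bigD1 w') //= eqxx (negbTE ne').
rewrite [X in _ * (_ * X)]big1 ?mulr1; last first.
  move=> x /andP [/negbTE -> /negbTE ->].
  by rewrite -[RHS](pk1 k); apply: eq_bigr => z _; rewrite !mulr1.
congr (_ * _).
  by rewrite -[RHS](sum_delta (fun z => pk z)); apply: eq_bigr => z _; rewrite mulr1.
by rewrite -[RHS](sum_delta (fun z => pk z)); apply: eq_bigr => z _; rewrite mul1r.
Qed.

Lemma sum_pushforward (W T : finType) (P : W -> R) (f : W -> T) (F : T -> R) :
  \sum_w P w * F (f w) = \sum_t F t * \sum_w P w * (f w == t)%:R.
Proof.
under [RHS]eq_bigr do rewrite big_distrr /=.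
rewrite exchange_big /=; apply: eq_bigr => w _.
rewrite -(sum_delta (fun t => P w * F t)); apply: eq_bigr => t _.
by rewrite eq_sym mulrCA mulrA.
Qed.

(* Two words of the random codebook have independent components exactly where
   their indices differ. *)
Lemma pair_law (F : vec -> vec -> R) (w w' : idx) :
  \sum_l lam l * F (pick_word l w) (pick_word l w') =
  \sum_v \sum_v' pv v * pv v' * F v (mix (fun k => w k != w' k) v v').
Proof.
rewrite (sum_pushforward _ (fun l => (pick_word l w, pick_word l w'))
  (fun ab => F ab.1 ab.2)).
rewrite pair_bigA /= (sum_pushforward (fun vv : vec * vec => pv vv.1 * pv vv.2)
   (fun vv => (vv.1, mix (fun k => w k != w' k) vv.1 vv.2))
   (fun ab => F ab.1 ab.2)).
apply: eq_bigr => -[a b] _; congr (_ * _).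
transitivity (\prod_k (if w k != w' k then pk (a k) * pk (b k)
                       else pk (a k) * (a k == b k)%:R)).
  rewrite -[RHS](eq_bigr _ (fun k _ => pair_letter_law (w k) (w' k) (a k) (b k))).
  rewrite -(big_dffun_distr (fun k (g : {ffun Ix k -> Al k}) =>
    (\prod_x pk (g x)) * ((g (w k) == a k)%:R * (g (w' k) == b k)%:R))).
  apply: eq_bigr => l _; rewrite !big_split /= -!natr_forall -natrM mulnb.
  congr (_ * (_ : bool)%:R); rewrite xpair_eqE !dffun_eqE.
  by congr (_ && _); apply: eq_forallb => k; rewrite ffunE.
under eq_bigr => k _.
  have -> : (if w k != w' k then pk (a k) * pk (b k)
             else pk (a k) * (a k == b k)%:R) =
     pk (a k) * \sum_x pk x * ((if w k != w' k then x else a k) == b k)%:R.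
    case: ifP => _; first by rewrite sum_delta.
    by rewrite -big_distrl /= pk1 mul1r.
  over.
rewrite big_split /= -(big_dffun_distr (fun k x =>
   pk x * ((if w k != w' k then x else a k) == b k)%:R)).
rewrite -(pair_bigA _ (fun v v' => pv v * pv v' *
  ((v, mix (fun k => w k != w' k) v v') == (a, b))%:R)) /=.
under [RHS]eq_bigr => v _.
  under eq_bigr => v' _ do
    rewrite xpair_eqE -mulnb natrM [X in _ * X]mulrC mulrA.
  rewrite -big_distrl /=; over.
rewrite (sum_delta (fun v => \sum_v' pv v * pv v' *
    (mix (fun k => w k != w' k) v v' == b)%:R)).
rewrite big_distrr /=; apply: eq_bigr => v' _.
rewrite big_split /= mulrA -natr_forall; congr (_ * (_ : bool)%:R).
by rewrite dffun_eqE; apply: eq_forallb => k; rewrite ffunE.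
Qed.

Lemma word_law (F : vec -> R) (w : idx) :
  \sum_l lam l * F (pick_word l w) = \sum_v pv v * F v.
Proof.
rewrite (pair_law (fun v _ => F v) w w); apply: eq_bigr => v _.
by rewrite -big_distrl /= -big_distrr /= sum_pv mulr1.
Qed.

End PairLaw.

(** Resampling the coordinates in [T] preserves the law: the mixed vector is the second word of a
    two-word codebook whose indices differ exactly on [T]. *)
Lemma mix_law (R : comPzSemiRingType) (V : finType) (Al : V -> finType)
    (pk : forall k, Al k -> R) (pk1 : forall k, \sum_(x : Al k) pk k x = 1)
    (T : pred V) (F : vec Al -> R) :
  \sum_v \sum_v' pv pk v * pv pk v' * F (mix T v v') = \sum_v pv pk v * F v.
Proof.
pose w : idx (fun=> bool) := [ffun k : V => false].
pose w' : idx (fun=> bool) := [ffun k : V => T k].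
rewrite -(word_law pk1 F w') (pair_law pk1 (fun _ v => F v) w w').
apply: eq_bigr => v _; apply: eq_bigr => v' _; congr (_ * F _).
by apply/ffunP => k; rewrite !ffunE; case: (T k).
Qed.

Lemma sum_zip (R : nmodType) (I A B : finType)
    (F : {ffun I -> A} -> {ffun I -> B} -> R) :
  \sum_a \sum_b F a b =
  \sum_(z : {ffun I -> A * B}) F [ffun t => (z t).1] [ffun t => (z t).2].
Proof.
rewrite pair_bigA (reindex (fun z : {ffun I -> A * B} =>
  ([ffun t => (z t).1], [ffun t => (z t).2]))) //.
exists (fun ab : {ffun I -> A} * {ffun I -> B} => [ffun t : I => (ab.1 t, ab.2 t)]) => [z|[a b]] _.
  by apply/ffunP => t; rewrite !ffunE; case: (z t).
by congr (_, _); apply/ffunP => t; rewrite !ffunE.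
Qed.

(** * Chebyshev and Markov bounds for independent repetitions *)

Section ProductMeasure.
Context (R : realType) (Z : finType) (mu : Z -> R) (n : nat).
Hypothesis (mu_ge0 : forall z, 0 <= mu z) (mu1 : \sum_z mu z = 1).

Let block := {ffun 'I_n -> Z}.

(** After expanding the square, the terms with distinct times vanish by independence and centring;
    only the [n] diagonal terms remain. *)
Lemma sum_sqr_iid (g : Z -> R) : \sum_z mu z * g z = 0 ->
  \sum_(z : block) (\prod_t mu (z t)) * (\sum_t g (z t)) ^+ 2 =
  n%:R * \sum_z mu z * g z ^+ 2.
Proof.
move=> g0.
have cov (s s' : 'I_n) :
    \sum_(z : block) (\prod_t mu (z t)) * (g (z s) * g (z s')) =
    (s == s')%:R * \sum_z mu z * g z ^+ 2.
  pose G t x := mu x * ((if t == s then g x else 1) *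
                        (if t == s' then g x else 1)).
  transitivity (\sum_(z : block) \prod_t G t (z t)).
    apply: eq_bigr => z _; rewrite /G !big_split /=; congr (_ * (_ * _)).
      by rewrite (bigD1 s) //= eqxx big1 ?mulr1 // => x /negbTE ->.
    by rewrite (bigD1 s') //= eqxx big1 ?mulr1 // => x /negbTE ->.
  rewrite -bigA_distr_bigA /G (bigD1 s) //= eqxx.
  case: eqVneq => [<-|ne].
    rewrite [X in _ * X]big1 ?mul1r ?mulr1.
      by apply: eq_bigr => z _; rewrite expr2.
    by move=> t /negbTE ->; rewrite -[RHS]mu1; apply: eq_bigr => z _; rewrite !mulr1.
  by under eq_bigr do rewrite mulr1; rewrite g0 !mul0r.
under eq_bigr do rewrite expr2 big_distrlr /= big_distrr /=.
rewrite exchange_big /=.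
under eq_bigr => s _.
  under eq_bigr do rewrite big_distrr /=.
  rewrite exchange_big /=.
  under eq_bigr do rewrite cov.
  rewrite -big_distrl /= (bigD1 s) //= eqxx big1 ?addr0 ?mul1r; last first.
    by move=> s' /negbTE; rewrite eq_sym => ->.
  over.
by rewrite sumr_const card_ord mulr_natl.
Qed.

Lemma chebyshev_lower (f : Z -> R) (eps : R) : (0 < n)%N -> 0 < eps ->
  forall m, m = \sum_z mu z * f z ->
  \sum_(z : block | \sum_t f (z t) < n%:R * (m - eps)) \prod_t mu (z t) <=
  (\sum_z mu z * (f z - m) ^+ 2) / (n%:R * eps ^+ 2).
Proof.
move=> n0 e0 m mE; have nR : 0 < n%:R :> R by rewrite ltr0n.
have ne : 0 < n%:R * eps :> R by rewrite mulr_gt0.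
rewrite ler_pdivlMr ?mulr_gt0 ?exprn_gt0 //.
rewrite -(ler_pM2l nR) -sum_sqr_iid; last first.
  by under eq_bigr do rewrite mulrBr; rewrite sumrB -big_distrl /= mu1 mul1r -mE subrr.
have -> (x : R) : n%:R * (x * (n%:R * eps ^+ 2)) = x * (n%:R * eps) ^+ 2 by ring.
rewrite big_distrl /= big_mkcond /=; apply: ler_sum => z _.
have p0 : 0 <= \prod_t mu (z t) by apply: prodr_ge0.
case: ifP => [lt|_]; last by rewrite mulr_ge0 ?sqr_ge0.
rewrite ler_wpM2l // sumrB sumr_const card_ord -mulr_natl.
rewrite -[leRHS]sqrrN ler_pXn2r // ?nnegrE ?(ltW ne) //; lra.
Qed.

Lemma log2_prod (I : finType) (F : I -> R) : (forall i, 0 < F i) ->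
  log2 (\prod_i F i) = \sum_i log2 (F i).
Proof.
move=> F0; rewrite /log2 -big_distrl /=; congr (_ / _).
suff [_ ->] : 0 < \prod_i F i /\ ln (\prod_i F i) = \sum_i ln (F i) by [].
elim/big_rec2: _ => [|i x y _ [y0 IH]]; first by rewrite ln1.
by rewrite mulr_gt0 // lnM ?posrE // IH.
Qed.

Lemma ln2_gt0 : 0 < ln 2 :> R.
Proof. by rewrite ln_gt0 // ltr1n. Qed.

Lemma lt_log2 (x y : R) : 0 < x -> x < 2 `^ y -> log2 x < y.
Proof.
move=> x0; rewrite /log2 ltr_pdivrMr ?ln2_gt0 // -ln_powR.
by rewrite ltr_ln ?posrE // powR_gt0.
Qed.

(** The logarithm turns the product test into the event of [chebyshev_lower]. This needs every
    factor [rho] to be positive, which can only fail on blocks of probability 0. *)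
Lemma true_word_fails (rho : Z -> R) (eps : R) : (0 < n)%N -> 0 < eps ->
  (forall z, 0 < mu z -> 0 < rho z) ->
  forall m, m = \sum_z mu z * log2 (rho z) ->
  \sum_(z : block | \prod_t rho (z t) < 2 `^ (n%:R * (m - eps)))
     \prod_t mu (z t) <=
  (\sum_z mu z * (log2 (rho z) - m) ^+ 2) / (n%:R * eps ^+ 2).
Proof.
move=> n0 e0 rho0 m mE.
have H := chebyshev_lower (f := fun z => log2 (rho z)) n0 e0 mE.
apply: le_trans H.
rewrite big_mkcond [leRHS]big_mkcond /=; apply: ler_sum => z _.
have p0 : 0 <= \prod_t mu (z t) by apply: prodr_ge0.
case: ifP => [lt|_]; last by case: ifP.
case: ifP => // nlt; rewrite le_eqVlt; apply/orP; left; apply/negPn/negP => pN0.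
move/negP: nlt; apply; have mu_gt0 t : 0 < mu (z t).
  by rewrite lt_neqAle mu_ge0 andbT eq_sym; move/prodf_neq0: pN0; exact.
rewrite -log2_prod; last by move=> t; exact: rho0.
by apply: lt_log2 lt; apply: prodr_gt0 => t _; exact: rho0.
Qed.

(** Markov's inequality: by independence the expectation of the product is a product of
    expectations, each at most 1. *)
Lemma wrong_word_passes (rho : Z -> R) (tau : R) :
  (forall z, 0 <= rho z) -> \sum_z mu z * rho z <= 1 ->
  \sum_(z : block | 2 `^ (n%:R * tau) <= \prod_t rho (z t))
     \prod_t mu (z t) <= 2 `^ (- (n%:R * tau)).
Proof.
move=> rho0 le1; rewrite powRN -[leRHS]mul1r ler_pdivlMr ?powR_gt0 //.
apply: le_trans (_ : \sum_(z : block) \prod_t (mu (z t) * rho (z t)) <= 1).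
  rewrite big_distrl /= big_mkcond /=; apply: ler_sum => z _.
  rewrite big_split /=; have p0 : 0 <= \prod_t mu (z t) by apply: prodr_ge0.
  case: ifP => [le|_]; first by rewrite ler_wpM2l.
  by rewrite mulr_ge0 // prodr_ge0.
rewrite -(bigA_distr_bigA (fun=> fun z => mu z * rho z)) /=.
by apply: prodr_ile1 => t _; rewrite le1 sumr_ge0 // => z _; rewrite mulr_ge0.
Qed.

End ProductMeasure.

(** * Likelihood ratio tests averaged over the random codebook *)

Section RandomCode.
Context (R : realType) (V : finType) (Al Ix : V -> finType).
Context (pk : forall k, Al k -> R).
Hypothesis (pk1 : forall k, \sum_(x : Al k) pk x = 1).
Hypothesis (pk_ge0 : forall k (x : Al k), 0 <= pk x).
Context (Y : finType) (W : vec Al -> Y -> R).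
Hypothesis (W_pmf : forall v, is_pmf (W v)).
Context (n : nat).

Definition book : finType := {ffun 'I_n -> letter Al Ix}.
Definition book_law (b : book) : R := \prod_t lam pk (b t).
Definition block_law (b : book) (w : idx Ix) (y : {ffun 'I_n -> Y}) : R :=
  \prod_t W (pick_word (b t) w) (y t).

Lemma pv_ge0 (v : vec Al) : 0 <= pv pk v.
Proof. by apply: prodr_ge0 => k _; exact: pk_ge0. Qed.

Lemma lam_ge0 (l : letter Al Ix) : 0 <= lam pk l.
Proof. by apply: prodr_ge0 => k _; apply: prodr_ge0 => a _; exact: pk_ge0. Qed.

Lemma book_law_ge0 b : 0 <= book_law b.
Proof. by apply: prodr_ge0 => t _; exact: lam_ge0. Qed.

Lemma sum_book_law : \sum_b book_law b = 1.
Proof.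
rewrite -(bigA_distr_bigA (fun=> fun l : letter Al Ix => lam pk l)) /=.
by rewrite big1 // => t _; exact: sum_lam.
Qed.

Lemma block_law_ge0 b w y : 0 <= block_law b w y.
Proof. by apply: prodr_ge0 => t _; case: (W_pmf (pick_word (b t) w)). Qed.

(** The joint law, at one time instant, of the codebook letter and of the output when the word [w]
    is sent. *)
Let mu (w : idx Ix) (z : letter Al Ix * Y) : R :=
  lam pk z.1 * W (pick_word z.1 w) z.2.

Let mu_ge0 w z : 0 <= mu w z.
Proof.
by rewrite mulr_ge0 ?lam_ge0 //; case: (W_pmf (pick_word z.1 w)).
Qed.

Let mu_exp w w' (G : vec Al -> Y -> R) :
  \sum_z mu w z * G (pick_word z.1 w') z.2 =
  \sum_v \sum_v' pv pk v * pv pk v' *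
    \sum_y W v y * G (mix (fun k => w k != w' k) v v') y.
Proof.
rewrite -(pair_law pk1 (fun v v' => \sum_y W v y * G v' y)).
rewrite -(pair_bigA _ (fun l y => mu w (l, y) * G (pick_word l w') y)) /=.
apply: eq_bigr => l _; rewrite big_distrr /=.
by apply: eq_bigr => y _; rewrite mulrA.
Qed.

Let mu_exp1 w (G : vec Al -> Y -> R) :
  \sum_z mu w z * G (pick_word z.1 w) z.2 =
  \sum_v \sum_y pv pk v * W v y * G v y.
Proof.
under [RHS]eq_bigr do (under eq_bigr do rewrite -mulrA; rewrite -big_distrr /=).
rewrite -(word_law pk1 (fun v => \sum_y W v y * G v y) w).
rewrite -(pair_bigA _ (fun l y => mu w (l, y) * G (pick_word l w) y)) /=.
apply: eq_bigr => l _; rewrite big_distrr /=.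
by apply: eq_bigr => y _; rewrite mulrA.
Qed.

Let mu1 w : \sum_z mu w z = 1.
Proof.
under eq_bigr do rewrite -[mu _ _]mulr1.
rewrite (mu_exp1 w (fun _ _ => 1)) -[RHS](sum_pv pk1).
apply: eq_bigr => v _; under eq_bigr do rewrite mulr1.
by rewrite -big_distrr /=; case: (W_pmf v) => _ ->; rewrite mulr1.
Qed.

(** Codebook and output block together form a sequence of independent pairs of law [mu w], so that
    averages over codebooks become probabilities under a product measure. *)
Let zip_blocks w (p : {ffun 'I_n -> vec Al} -> {ffun 'I_n -> Y} -> bool) w' :
  \sum_b book_law b *
     \sum_(y | p [ffun t => pick_word (b t) w'] y) block_law b w y =
  \sum_(z : {ffun 'I_n -> letter Al Ix * Y} |
        p [ffun t => pick_word (z t).1 w'] [ffun t => (z t).2])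
     \prod_t mu w (z t).
Proof.
under eq_bigr do rewrite big_mkcond big_distrr /=.
rewrite sum_zip [RHS]big_mkcond /=; apply: eq_bigr => z _.
rewrite (_ : [ffun t => pick_word ([ffun t0 => (z t0).1] t) w'] =
             [ffun t => pick_word (z t).1 w']); last first.
  by apply/ffunP => t; rewrite !ffunE.
case: ifP => _; last by rewrite mulr0.
rewrite /book_law /block_law -big_split /=.
by apply: eq_bigr => t _; rewrite !ffunE.
Qed.

Lemma true_word_law (w : idx Ix) (rho : vec Al -> Y -> R) (eps : R) :
  (0 < n)%N -> 0 < eps ->
  (forall v y, 0 < pv pk v -> 0 < W v y -> 0 < rho v y) ->
  forall m, m = \sum_v \sum_y pv pk v * W v y * log2 (rho v y) ->
  \sum_b book_law b *
    \sum_(y : {ffun 'I_n -> Y} | \prod_t rho (pick_word (b t) w) (y t) < 2 `^ (n%:R * (m - eps)))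
       block_law b w y <=
  (\sum_v \sum_y pv pk v * W v y * (log2 (rho v y) - m) ^+ 2) /
    (n%:R * eps ^+ 2).
Proof.
move=> n0 e0 rho0 m m_def.
have := @zip_blocks w (fun (v : {ffun 'I_n -> vec Al}) (y : {ffun 'I_n -> Y}) => \prod_t rho (v t) (y t) < 2 `^ (n%:R * (m - eps))) w.
under eq_bigr => b _ do under eq_bigl do
  (under eq_bigr do rewrite ffunE).
move=> ->.
pose r (z : letter Al Ix * Y) := rho (pick_word z.1 w) z.2.
have mE : m = \sum_z mu w z * log2 (r z).
  by rewrite m_def (mu_exp1 w (fun v y => log2 (rho v y))).
rewrite -(mu_exp1 w (fun v y => (log2 (rho v y) - m) ^+ 2)).
under eq_bigl do (under eq_bigr do rewrite !ffunE).
apply: (true_word_fails (mu_ge0 w) (mu1 w) n0 e0 _ mE) => z.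
rewrite lt_neqAle mu_ge0 andbT eq_sym mulf_eq0 negb_or => /andP [l0 W0].
apply: rho0.
  apply: prodr_gt0 => k _; rewrite lt_neqAle pk_ge0 andbT eq_sym ffunE.
  by move/prodf_neq0/(_ k isT)/prodf_neq0: l0; exact.
rewrite lt_neqAle eq_sym W0 /=; by case: (W_pmf (pick_word z.1 w)).
Qed.

Lemma wrong_word_law (w w' : idx Ix) (rho : vec Al -> Y -> R) (tau : R) :
  (forall v y, 0 <= rho v y) ->
  \sum_v \sum_v' pv pk v * pv pk v' *
    \sum_y W v y * rho (mix (fun k => w k != w' k) v v') y <= 1 ->
  \sum_b book_law b *
    \sum_(y : {ffun 'I_n -> Y} | 2 `^ (n%:R * tau) <= \prod_t rho (pick_word (b t) w') (y t))
       block_law b w y <= 2 `^ (- (n%:R * tau)).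
Proof.
move=> rho0 le1.
have := @zip_blocks w (fun (v : {ffun 'I_n -> vec Al}) (y : {ffun 'I_n -> Y}) => 2 `^ (n%:R * tau) <= \prod_t rho (v t) (y t)) w'.
under eq_bigr => b _ do under eq_bigl do
  (under eq_bigr do rewrite ffunE).
move=> ->.
under eq_bigl do (under eq_bigr do rewrite !ffunE).
apply: (@wrong_word_passes _ _ (mu w) n (mu_ge0 w) (fun z => rho (pick_word z.1 w') z.2)) => //.
by rewrite mu_exp.
Qed.

End RandomCode.

(** * Conditional entropy *)

Section Entropy.
Context (R : realType) (W : finType) (P : W -> R).
Hypothesis P_ge0 : forall w, 0 <= P w.

Lemma prob_ge0 E : 0 <= prob P E.
Proof. by apply: sumr_ge0. Qed.

Lemma prob_gt0 (E : pred W) w : E w -> 0 < P w -> 0 < prob P E.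
Proof.
move=> Ew Pw; rewrite /prob (bigD1 w) //= ltr_pwDl //.
by apply: sumr_ge0.
Qed.

Lemma probE (E : pred W) : prob P E = \sum_w P w * (E w)%:R.
Proof.
rewrite /prob big_mkcond; apply: eq_bigr => w _.
by case: ifP; rewrite ?mulr1 ?mulr0.
Qed.

Lemma sum_prob (T : finType) (C : W -> T) (F : T -> R) :
  \sum_c prob P (fun w => C w == c) * F c = \sum_w P w * F (C w).
Proof.
rewrite (sum_pushforward _ C); apply: eq_bigr => c _.
by rewrite probE mulrC.
Qed.

(** The likelihood ratio p(b|a,c) / p(b|c), whose mean logarithm is I(A; B | C). *)
Definition cmi_ratio (TA TB TC : finType) (A : W -> TA) (B : W -> TB)
    (C : W -> TC) (a : TA) (b : TB) (c : TC) : R :=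
  prob P (fun w => [&& A w == a, B w == b & C w == c]) *
  prob P (fun w => C w == c) /
  (prob P (fun w => (A w == a) && (C w == c)) *
   prob P (fun w => (B w == b) && (C w == c))).

Definition cond_entropy (TB TC : finType) (B : W -> TB) (C : W -> TC) : R :=
  - \sum_w P w * log2 (prob P (fun w' => (B w' == B w) && (C w' == C w)) /
                       prob P (fun w' => C w' == C w)).

Lemma cmi_ratio_ge0 (TA TB TC : finType) (A : W -> TA) (B : W -> TB)
    (C : W -> TC) a b c : 0 <= cmi_ratio A B C a b c.
Proof. by rewrite divr_ge0 // mulr_ge0 // prob_ge0. Qed.

Lemma cond_mutual_info_exp (TA TB TC : finType) (A : W -> TA) (B : W -> TB)
    (C : W -> TC) :
  cond_mutual_info P A B C =
  \sum_w P w * log2 (cmi_ratio A B C (A w) (B w) (C w)).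
Proof.
rewrite -(sum_prob (fun w => (A w, B w, C w))
  (fun abc => log2 (cmi_ratio A B C abc.1.1 abc.1.2 abc.2))).
rewrite /cond_mutual_info pair_bigA pair_bigA /=.
apply: eq_bigr => -[[a b] c] _ /=; congr (_ * _); apply: eq_bigl => w.
by rewrite !xpair_eqE andbA.
Qed.

Lemma cond_mutual_info_entropy (TA TB TC : finType) (A : W -> TA)
    (B : W -> TB) (C : W -> TC) :
  cond_mutual_info P A B C =
  cond_entropy B C - cond_entropy B (fun w => (A w, C w)).
Proof.
rewrite cond_mutual_info_exp /cond_entropy opprK addrC -sumrB.
apply: eq_bigr => w _; have := P_ge0 w; rewrite le_eqVlt => /predU1P [<-|Pw].
  by rewrite !mul0r subr0.
rewrite -mulrBr; congr (_ * _).
have E1 : prob P (fun w' => (B w' == B w) && ((A w', C w') == (A w, C w))) =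
  prob P (fun w' => [&& A w' == A w, B w' == B w & C w' == C w]).
  by apply: eq_bigl => w'; rewrite xpair_eqE andbCA.
have E2 : prob P (fun w' => (A w', C w') == (A w, C w)) =
  prob P (fun w' => (A w' == A w) && (C w' == C w)).
  by apply: eq_bigl => w'; rewrite xpair_eqE.
rewrite E1 E2 /cmi_ratio /log2 -mulrBl; congr (_ / _).
set pabc := prob _ _; set pc := prob _ _; set pac := prob _ _.
set pbc := prob _ _.
have pabc0 : 0 < pabc by rewrite (@prob_gt0 _ w) ?eqxx.
have pc0 : 0 < pc by rewrite (@prob_gt0 _ w) ?eqxx.
have pac0 : 0 < pac by rewrite (@prob_gt0 _ w) ?eqxx.
have pbc0 : 0 < pbc by rewrite (@prob_gt0 _ w) ?eqxx.
rewrite !ln_div ?posrE ?mulr_gt0 // !lnM ?posrE //; ring.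
Qed.

Lemma ln_le_subr1 (x : R) : 0 < x -> ln x <= x - 1.
Proof.
move=> x0; have := @le_ln1Dx R (x - 1); rewrite addrCA subrr addr0; apply; lra.
Qed.

(** Gibbs' inequality for a substochastic kernel [r], from ln x <= x - 1 applied to the quotient of
    [r] by the true conditional probability. *)
Lemma cond_entropy_le_cross (TB TC : finType) (B : W -> TB) (C : W -> TC)
    (r : TB -> TC -> R) :
  (forall b c, 0 <= r b c) -> (forall c, \sum_b r b c <= 1) ->
  (forall w, 0 < P w -> 0 < r (B w) (C w)) ->
  cond_entropy B C <= - \sum_w P w * log2 (r (B w) (C w)).
Proof.
move=> r0 r1 rP; rewrite lerN2 -subr_ge0 -sumrB.
pose pbc w := prob P (fun w' => (B w' == B w) && (C w' == C w)).
pose pc w := prob P (fun w' => C w' == C w).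
have key w : P w * (1 - r (B w) (C w) * pc w / pbc w) / ln 2 <=
    P w * log2 (pbc w / pc w) - P w * log2 (r (B w) (C w)).
  have := P_ge0 w; rewrite le_eqVlt => /predU1P [<-|Pw].
    by rewrite !mul0r subr0.
  rewrite -mulrBr -mulrA ler_wpM2l // /log2 -mulrBl.
  rewrite ler_pM2r ?invr_gt0 ?ln2_gt0 //.
  have pbc0 : 0 < pbc w by rewrite (@prob_gt0 _ w) ?eqxx.
  have pc0 : 0 < pc w by rewrite (@prob_gt0 _ w) ?eqxx.
  have rw := rP _ Pw.
  have /ln_le_subr1 : 0 < r (B w) (C w) * pc w / pbc w.
    by rewrite divr_gt0 // mulr_gt0.
  by rewrite !ln_div ?posrE ?mulr_gt0 // lnM ?posrE //; lra.
apply: le_trans (ler_sum _ (fun w _ => key w)).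
rewrite -big_distrl /= divr_ge0 ?(ltW (ln2_gt0 R)) //.
under eq_bigr do rewrite mulrBr mulr1; rewrite sumrB subr_ge0.
rewrite -[X in X <= _](sum_prob (fun w => (B w, C w)) (fun bc => r bc.1 bc.2 *
  prob P (fun w' => C w' == bc.2) /
  prob P (fun w' => (B w' == bc.1) && (C w' == bc.2)))).
apply: le_trans (_ : \sum_c prob P (fun w => C w == c) * 1 <= _); last first.
  by rewrite (sum_prob C (fun=> 1)); under eq_bigr do rewrite mulr1.
rewrite -(pair_bigA _ (fun b c => prob P (fun w => (B w, C w) == (b, c)) *
  (r b c * prob P (fun w' => C w' == c) /
  prob P (fun w' => (B w' == b) && (C w' == c))))) exchange_big /=.
apply: ler_sum => c _.
apply: le_trans (ler_wpM2l (prob_ge0 _) (r1 c)); rewrite big_distrr /=.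
apply: ler_sum => b _.
rewrite (_ : prob P (fun w => (B w, C w) == (b, c)) =
  prob P (fun w' => (B w' == b) && (C w' == c))); last first.
  by apply: eq_bigl => w; rewrite xpair_eqE.
have [-> | ne] := eqVneq (prob P (fun w' => (B w' == b) && (C w' == c))) 0.
  by rewrite mul0r mulr_ge0 ?prob_ge0.
by rewrite mulrC divfK // mulrC.
Qed.

Lemma prob_sum (T : finType) (B : W -> T) (E : pred W) :
  \sum_b prob P (fun w => (B w == b) && E w) = prob P E.
Proof.
rewrite /prob [RHS](partition_big B predT) //=; apply: eq_bigr => b _.
by apply: eq_bigl => w; rewrite andbC.
Qed.

(** Conditioning on more lowers entropy: Gibbs' inequality is applied with [r] the conditional law
    of [B] given [C'], read off at any point where [C] has the given value. The choice does not
    matter since [C] determines [C']. *)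
Lemma cond_entropy_fun (TB TC TC' : finType) (B : W -> TB) (C : W -> TC)
    (C' : W -> TC') :
  (forall w w', C w = C w' -> C' w = C' w') ->
  cond_entropy B C <= cond_entropy B C'.
Proof.
move=> CC'; pose r b c := if [pick w | C w == c] is Some w then
  prob P (fun w' => (B w' == b) && (C' w' == C' w)) /
  prob P (fun w' => C' w' == C' w) else 0.
have rE w : r (B w) (C w) = prob P (fun w' => (B w' == B w) && (C' w' == C' w)) /
  prob P (fun w' => C' w' == C' w).
  rewrite /r; case: pickP => [w' /eqP /CC' -> //|/(_ w)]; by rewrite eqxx.
have := @cond_entropy_le_cross _ _ B C r.
under [in X in _ -> _ -> _ -> X]eq_bigr do rewrite rE.
apply=> [b c|c|w Pw].
- by rewrite /r; case: pickP => // w _; rewrite divr_ge0 ?prob_ge0.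
- rewrite /r; case: pickP => [w _|_]; last by rewrite big1.
  rewrite -big_distrl /= prob_sum.
  have [->|ne] := eqVneq (prob P (fun w' => C' w' == C' w)) 0.
    by rewrite mul0r.
  by rewrite divff.
- by rewrite rE divr_gt0 // (@prob_gt0 _ w) ?eqxx.
Qed.

Lemma cond_entropy_equiv (TB TC TC' : finType) (B : W -> TB) (C : W -> TC)
    (C' : W -> TC') :
  (forall w w', C w = C w' <-> C' w = C' w') ->
  cond_entropy B C = cond_entropy B C'.
Proof.
by move=> h; apply/le_anti/andP; split; apply: cond_entropy_fun => w w' /h.
Qed.

(** The factorization expresses that [B] and [D] are independent given [C]; [alpha] and [beta] need
    not be normalized, as their sums [ac] and [bc] cancel. *)
Lemma cond_entropy_markov (TB TC TD : finType) (B : W -> TB) (C : W -> TC)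
    (D : W -> TD) (alpha : TD -> TC -> R) (beta : TB -> TC -> R) :
  (forall b c d, prob P (fun w => [&& D w == d, B w == b & C w == c]) =
                 alpha d c * beta b c) ->
  cond_entropy B (fun w => (D w, C w)) = cond_entropy B C.
Proof.
move=> h; congr (- _); apply: eq_bigr => w _.
have := P_ge0 w; rewrite le_eqVlt => /predU1P [<-|Pw]; first by rewrite !mul0r.
congr (_ * log2 _).
pose ac := \sum_d alpha d (C w); pose bc := \sum_b beta b (C w).
have hb b : prob P (fun w' => (B w' == b) && (C w' == C w)) = ac * beta b (C w).
  rewrite -(prob_sum D (fun w' => (B w' == b) && (C w' == C w))).
  by rewrite big_distrl /=; apply: eq_bigr => d _; rewrite h.
have hc : prob P (fun w' => C w' == C w) = ac * bc.
  by rewrite -(prob_sum B) big_distrr /=; apply: eq_bigr => b _; rewrite hb.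
have hd d : prob P (fun w' => (D w' == d) && (C w' == C w)) = alpha d (C w) * bc.
  rewrite -(prob_sum B) big_distrr /=; apply: eq_bigr => b _; rewrite -h.
  by apply: eq_bigl => w'; rewrite andbCA.
have -> : prob P (fun w' => (B w' == B w) && ((D w', C w') == (D w, C w))) =
  alpha (D w) (C w) * beta (B w) (C w).
  by rewrite -h; apply: eq_bigl => w'; rewrite xpair_eqE andbCA.
have hd' : prob P (fun w' => (D w', C w') == (D w, C w)) = alpha (D w) (C w) * bc.
  by rewrite -hd; apply: eq_bigl => w'; rewrite xpair_eqE.
have : 0 < prob P (fun w' => (D w', C w') == (D w, C w)).
  by rewrite (@prob_gt0 _ w) ?eqxx.
have : 0 < prob P (fun w' => C w' == C w) by rewrite (@prob_gt0 _ w) ?eqxx.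
rewrite hd' hb hc => /lt0r_neq0; rewrite mulf_eq0 negb_or => /andP [a0 b0].
move=> /lt0r_neq0; rewrite mulf_eq0 negb_or => /andP [a1 _].
by field; rewrite a0 a1 b0.
Qed.

End Entropy.

Lemma cond_entropy_eq_law (R : realType) (W W' TB TC : finType) (P : W -> R)
    (P' : W' -> R) (B : W -> TB) (C : W -> TC) (B' : W' -> TB) (C' : W' -> TC) :
  (forall b c, prob P (fun w => (B w == b) && (C w == c)) =
               prob P' (fun w => (B' w == b) && (C' w == c))) ->
  cond_entropy P B C = cond_entropy P' B' C'.
Proof.
move=> h; have hc c : prob P (fun w => C w == c) = prob P' (fun w => C' w == c).
  by rewrite -(prob_sum P B) -(prob_sum P' B'); apply: eq_bigr.
congr (- _).
rewrite -(sum_prob P (fun w => (B w, C w)) (fun bc => log2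
  (prob P (fun w' => (B w' == bc.1) && (C w' == bc.2)) /
   prob P (fun w' => C w' == bc.2)))).
rewrite -(sum_prob P' (fun w => (B' w, C' w)) (fun bc => log2
  (prob P' (fun w' => (B' w' == bc.1) && (C' w' == bc.2)) /
   prob P' (fun w' => C' w' == bc.2)))).
by apply: eq_bigr => -[b c] _ /=; rewrite h hc; congr (_ * _).
Qed.

(** * The set functions as entropies *)

Lemma big_prod (M : nmodType) (A B : finType) (F : A * B -> M) :
  \sum_z F z = \sum_a \sum_b F (a, b).
Proof. by rewrite pair_bigA; apply: eq_bigr => -[]. Qed.

Section DPair.
Context (T : cell -> finType).

(** Matching on [i] first makes the types of both components compute. *)
Definition dpair (i : cell) : T i -> T (~~ i) -> {dffun forall i, T i} :=
  match i with
  | false => fun (a : T false) (b : T true) =>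
      [ffun k => match k with false => a | true => b end]
  | true => fun (a : T true) (b : T false) =>
      [ffun k => match k with true => a | false => b end]
  end.

Lemma dpairE1 i (a : T i) (b : T (~~ i)) : dpair a b i = a.
Proof. by case: i a b => a b /=; rewrite ffunE. Qed.

Lemma dpairE2 i (a : T i) (b : T (~~ i)) : dpair a b (~~ i) = b.
Proof. by case: i a b => a b /=; rewrite ffunE. Qed.

Lemma dpair_eta i (f : {dffun forall i, T i}) : dpair (f i) (f (~~ i)) = f.
Proof. by case: i => /=; apply/ffunP => -[]; rewrite ffunE. Qed.

Lemma big_dpair (R : nmodType) (i : cell) (F : {dffun forall i, T i} -> R) :
  \sum_f F f = \sum_(a : T i) \sum_(b : T (~~ i)) F (dpair a b).
Proof.
rewrite pair_bigA (reindex (fun p : T i * T (~~ i) => dpair p.1 p.2)) //.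
exists (fun f : {dffun forall i, T i} => (f i, f (~~ i))) => [[a b]|f] _ /=.
  by rewrite dpairE1 dpairE2.
exact: dpair_eta.
Qed.

Lemma big_cell (S : Type) (idx : S) (op : Monoid.com_law idx) (i : cell)
    (F : cell -> S) : \big[op/idx]_k F k = op (F i) (F (~~ i)).
Proof. by rewrite big_bool; case: i => //=; rewrite Monoid.mulmC. Qed.

End DPair.

Section Channel.
Context (R : realType) (ch : mac_ic_mac R).

Definition cell_law (i : cell) (x : inputs ch) (y : out ch i) : R :=
  law ch i (x i) (x (~~ i) (user1 ch (~~ i))) y.

Lemma cell_law_pmf i x : is_pmf (@cell_law i x).
Proof. exact: law_pmf. Qed.

Context (Q : finType) (U : cell -> finType).

(** Given the inputs, the output at the other receiver is independent of the one at [i], and it sums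
    out to 1. *)
Lemma sum_joint_law (P : Q * aux U * inputs ch -> R) (i : cell)
    (G : Q * aux U * inputs ch -> out ch i -> R) :
  \sum_(w : Defs.space ch Q U) joint_law P w * G w.1 (w.2 i) =
  \sum_z P z * \sum_y cell_law z.2 y * G z y.
Proof.
rewrite -(pair_bigA _ (fun z y => joint_law P (z, y) * G z (y i))) /=.
apply: eq_bigr => z _; rewrite /joint_law /=.
under eq_bigr do rewrite -mulrA; rewrite -big_distrr /=; congr (_ * _).
rewrite (big_dpair i); apply: eq_bigr => a _.
under eq_bigr do rewrite dpairE1 /channel_law (big_cell _ i) dpairE1 dpairE2
  mulrAC.
by rewrite -big_distrr /= (cell_law_pmf (~~ i) z.2).2 mulr1.
Qed.

Section CodingDist.
Context (P : Q * aux U * inputs ch -> R).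
Context (pQ : Q -> R) (pUX : forall i, Q -> U i * inp ch i (user1 ch i) -> R).
Context (pX : forall i (j : 'I_(K ch i)), Q -> inp ch i j -> R).
Arguments pUX : clear implicits.
Arguments pX : clear implicits.
Hypothesis pQ_pmf : is_pmf pQ.
Hypothesis pUX_pmf : forall i q, is_pmf (pUX i q).
Hypothesis pX_pmf : forall i j q, j != user1 ch i -> is_pmf (pX i j q).
Hypothesis PE : forall q u x, P (q, u, x) =
  pQ q * \prod_(i : cell) (pUX i q (u i, x i (user1 ch i)) *
                           \prod_(j | j != user1 ch i) pX i j q (x i j)).

Lemma coding_dist_ge0 z : 0 <= P z.
Proof.
case: z => [[q u] x]; rewrite PE mulr_ge0 ?prodr_ge0 //; first by case: pQ_pmf.
move=> i _; rewrite mulr_ge0 ?prodr_ge0 //; first by case: (pUX_pmf i q).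
by move=> j /(@pX_pmf i j q) [].
Qed.

Lemma joint_law_ge0 (w : Defs.space ch Q U) : 0 <= joint_law P w.
Proof.
rewrite mulr_ge0 ?coding_dist_ge0 // /channel_law prodr_ge0 // => i _.
exact: (@cell_law_pmf i w.1.2).1.
Qed.

Definition opt (T : Type) (a : bool) (x : T) : option T :=
  if a then Some x else None.

(** The switches [a] and [b] say whether U_i and U_{i'} are conditioned on; a switched-off variable
    becomes the constant [None], so that all the conditional entropies are instances of a single
    one, [HY]. *)
Definition cvar (i : cell) (S : {set 'I_(K ch i)}) (a b : bool)
    (w : Defs.space ch Q U) :=
  (opt a (rvU i w), (rvX S w, opt b (rvU (~~ i) w), rvQ w)).

Definition HY (i : cell) (S : {set 'I_(K ch i)}) (a b : bool) : R :=
  cond_entropy (joint_law P) (@rvY _ ch Q U i) (cvar S a b).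

Arguments HY : clear implicits.

Lemma rvX_eqP (i : cell) (S : {set 'I_(K ch i)}) (w w' : Defs.space ch Q U) :
  rvX S w = rvX S w' <-> (forall j, j \in S -> w.1.2 i j = w'.1.2 i j).
Proof.
split=> [/ffunP e j jS|e]; last by apply/ffunP => -[j jS]; rewrite !ffunE e.
by have := e (exist _ j jS); rewrite !ffunE.
Qed.

Lemma HY_mono i (S S' : {set 'I_(K ch i)}) (a a' b b' : bool) :
  S \subset S' -> (a <= a')%N -> (b <= b')%N -> HY i S' a' b' <= HY i S a b.
Proof.
move=> /fintype.subsetP sS la lb; apply: cond_entropy_fun; first exact: joint_law_ge0.
move=> w w' [ea /rvX_eqP ex eb eq]; congr (_, (_, _, _)) => //.
- by case: a a' la ea => [] [].
- by apply/rvX_eqP => j /sS; exact: ex.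
- by case: b b' lb eb => [] [].
Qed.

(** U_i enters the joint law only through p(u_i, x_{i.1} | q). Once X_{i.1} and Q are given, this
    factor is the [alpha] of [cond_entropy_markov], and all else, summed over what is not
    conditioned on, is its [beta]. *)
Lemma HY_markov i (S : {set 'I_(K ch i)}) (b : bool) :
  user1 ch i \in S -> HY i S true b = HY i S false b.
Proof.
move=> uS; rewrite /HY.
pose Cb (q : Q) (u' : U (~~ i)) (x : inputs ch) :=
  ([ffun j => x i (val j)] :
     {dffun forall j : {j : 'I_(K ch i) | j \in S}, inp ch i (val j)},
   opt b u', q).
pose C (w : Defs.space ch Q U) := Cb w.1.1.1 (w.1.1.2 (~~ i)) w.1.2.
transitivity (cond_entropy (joint_law P) (@rvY _ ch Q U i)
                (fun w => (rvU i w, C w))).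
  apply: cond_entropy_equiv; first exact: joint_law_ge0.
  by move=> w w'; split=> -[eu ex eb eq];
    [congr (_, (_, _, _))|congr (Some _, (_, _, _))].
transitivity (cond_entropy (joint_law P) (@rvY _ ch Q U i) C); last first.
  apply: cond_entropy_equiv; first exact: joint_law_ge0.
  by move=> w w'; split=> -[ex eb eq]; [congr (None, (_, _, _))|congr (_, _, _)].
pose rest q (u' : U (~~ i)) (x : inputs ch) := pQ q * (\prod_(j | j != user1 ch i) pX i j q (x i j) *
  (pUX (~~ i) q (u', x (~~ i) (user1 ch (~~ i))) *
   \prod_(j | j != user1 ch (~~ i)) pX (~~ i) j q (x (~~ i) j))).
apply: (@cond_entropy_markov _ _ _ joint_law_ge0 _ _ _ (@rvY _ ch Q U i) C (@rvU _ ch Q U i)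
  (fun d c => pUX i c.2 (d, c.1.1 (exist _ (user1 ch i) uS)))
  (fun y c => \sum_q \sum_u' \sum_x (Cb q u' x == c)%:R * rest q u' x *
     cell_law x y)) => y c d.
rewrite probE (sum_joint_law P (i := i) (fun z y' =>
  [&& z.1.2 i == d, y' == y & Cb z.1.1 (z.1.2 (~~ i)) z.2 == c]%:R)).
rewrite !big_prod /=.
rewrite big_distrr /=; apply: eq_bigr => q _.
rewrite (big_dpair i) exchange_big big_distrr /=; apply: eq_bigr => u' _.
rewrite exchange_big big_distrr /=; apply: eq_bigr => x _.
transitivity (\sum_a (pUX i q (a, x i (user1 ch i)) * ((Cb q u' x == c)%:R *
  rest q u' x * cell_law x y)) * (a == d)%:R).
  apply: eq_bigr => a _; rewrite PE (big_cell _ i) /= dpairE1 dpairE2 /rest.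
  have -> : \sum_y' cell_law x y' * [&& a == d, y' == y & Cb q u' x == c]%:R =
     cell_law x y * ((Cb q u' x == c)%:R * (a == d)%:R).
    rewrite -(sum_delta (fun y' => cell_law x y' * ((Cb q u' x == c)%:R * (a == d)%:R))).
    apply: eq_bigr => y' _; case: (a == d); case: (y' == y);
    by case: (_ == c); rewrite ?mulr1 ?mulr0.
  by ring.
rewrite sum_delta.
have [eC|] := eqVneq; last by rewrite !mul0r !mulr0.
by rewrite -eC /= ffunE.
Qed.

Lemma rvX_setT (i : cell) (S : {set 'I_(K ch i)}) (w w' : Defs.space ch Q U) :
  rvX [set: 'I_(K ch i)] w = rvX [set: 'I_(K ch i)] w' <->
  rvX S w = rvX S w' /\ rvX (~: S) w = rvX (~: S) w'.
Proof.
rewrite !rvX_eqP; split=> [e|[e e'] j _].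
  by split=> j _; apply: e; rewrite inE.
by have [jS|jS] := boolP (j \in S); [exact: e|apply: e'; rewrite inE].
Qed.

Lemma HY_setT i b : HY i [set: 'I_(K ch i)] true b = HY i [set: 'I_(K ch i)] false b.
Proof. by apply: HY_markov; rewrite inE. Qed.

Lemma fA_HY i S : fA P S = HY i (~: S) true true - HY i [set: 'I_(K ch i)] false true.
Proof.
rewrite /fA cond_mutual_info_entropy; last exact: joint_law_ge0.
rewrite -HY_setT; congr (_ - _); apply: cond_entropy_equiv => [|w w'];
  try exact: joint_law_ge0.
  split=> -[ex eu eu' eq]; first by congr (Some _, (_, Some _, _)).
  by congr (_, _, _, _).
split=> [[ex ex' eu eu' eq]|[eu /(rvX_setT S) [ex ex'] eu' eq]].
  by congr (Some _, (_, Some _, _)) => //; apply/(rvX_setT S).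
by congr (_, (_, _, _, _)).
Qed.

Lemma fB_HY i S : fB P S = HY i (~: S) false true - HY i [set: 'I_(K ch i)] false true.
Proof.
rewrite /fB cond_mutual_info_entropy; last exact: joint_law_ge0.
congr (_ - _); apply: cond_entropy_equiv => [|w w'];
  try exact: joint_law_ge0.
split=> [[ex ex' eu' eq]|[/(rvX_setT S) [ex ex'] eu' eq]].
  by congr (None, (_, Some _, _)) => //; apply/(rvX_setT S).
by congr (_, (_, _, _)).
Qed.

Lemma fE_HY i S : fE P S = HY i (~: S) true false - HY i [set: 'I_(K ch i)] false true.
Proof.
rewrite /fE cond_mutual_info_entropy; last exact: joint_law_ge0.
rewrite -HY_setT; congr (_ - _); apply: cond_entropy_equiv => [|w w'];
  try exact: joint_law_ge0.
  split=> -[ex eu eq]; first by congr (Some _, (_, None, _)).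
  by congr (_, _, _).
split=> [[ex eu' ex' eu eq]|[eu /(rvX_setT S) [ex ex'] eu' eq]].
  by congr (Some _, (_, Some _, _)) => //; apply/(rvX_setT S).
by congr (_, _, (_, _, _)).
Qed.

Lemma fG_HY i S : fG P S = HY i (~: S) false false - HY i [set: 'I_(K ch i)] false true.
Proof.
rewrite /fG cond_mutual_info_entropy; last exact: joint_law_ge0.
congr (_ - _); apply: cond_entropy_equiv => [|w w'];
  try exact: joint_law_ge0.
  split=> -[ex eq]; first by congr (None, (_, None, _)).
  by congr (_, _).
split=> [[ex eu' ex' eq]|[/(rvX_setT S) [ex ex'] eu' eq]].
  by congr (None, (_, Some _, _)) => //; apply/(rvX_setT S).
by congr (_, _, (_, _)).
Qed.

End CodingDist.
End Channel.
Arguments HY {R ch Q U} P i S a b.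

(** An almost surely constant variable is independent of everything, hence a case of
    [cond_entropy_markov]. *)
Lemma cond_entropy_const (R : realType) (W : finType) (P : W -> R)
    (P_ge0 : forall w, 0 <= P w) (TB TC TD : finType) (B : W -> TB)
    (C : W -> TC) (D : W -> TD) (d0 : TD) :
  (forall w, P w != 0 -> D w = d0) ->
  cond_entropy P B (fun w => (D w, C w)) = cond_entropy P B C.
Proof.
move=> Dd0; apply: (@cond_entropy_markov _ _ _ P_ge0 _ _ _ B C D
  (fun d _ => (d == d0)%:R)
  (fun b c => prob P (fun w => (B w == b) && (C w == c)))) => b c d.
rewrite !probE big_distrr /=; apply: eq_bigr => w _.
have [->|/Dd0 ->] := eqVneq (P w) 0; first by rewrite !mul0r mulr0.
by rewrite mulrCA -natrM mulnb eq_sym.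
Qed.

(** * Making one auxiliary variable constant *)

Section Trivialize.
Context (R : realType) (ch : mac_ic_mac R) (Q : finType) (U : cell -> finType).
Context (P : Q * aux U * inputs ch -> R) (i0 : cell) (d0 : forall k, U k).

(** The variable U_{i0} keeps its alphabet but is concentrated on [d0 i0]; the law of everything
    else is the corresponding marginal of [P]. *)
Definition trivialize (z : Q * aux U * inputs ch) : R :=
  (z.1.2 i0 == d0 i0)%:R * \sum_a P (z.1.1, dpair a (z.1.2 (~~ i0)), z.2).

Lemma trivialize_coding_dist : coding_dist P -> coding_dist trivialize.
Proof.
move=> [pQ [pUX [pX [hQ hUX hX PE]]]].
pose pUX' k q (ux : U k * inp ch k (user1 ch k)) := if k == i0 then
  (ux.1 == d0 k)%:R * \sum_a pUX k q (a, ux.2) else pUX k q ux.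
exists pQ, pUX', pX; split=> // [k q|q u x].
  rewrite /pUX'; have [_|_] := eqVneq k i0; last exact: hUX.
  have [ge0 s1] := hUX k q; split=> [ux|].
    by rewrite mulr_ge0 // sumr_ge0.
  rewrite big_prod (bigD1 (d0 k)) //= [X in _ + X]big1 ?addr0; last first.
    by move=> a /negbTE ->; rewrite big1 // => x _; rewrite mul0r.
  under eq_bigr do rewrite eqxx mul1r.
  by rewrite exchange_big -s1 big_prod.
rewrite /trivialize /=.
under eq_bigr do rewrite PE (big_cell _ i0) /= dpairE1 dpairE2.
rewrite (big_cell _ i0) /= /pUX' eqxx; have -> : (~~ i0 == i0) = false by case: (i0).
rewrite -big_distrr /= -!big_distrl /=; ring.
Qed.

Lemma sum_trivialize (G : Q * aux U * inputs ch -> R) :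
  (forall q (u u' : aux U) x, (forall k, k != i0 -> u k = u' k) ->
    G (q, u, x) = G (q, u', x)) ->
  \sum_z trivialize z * G z = \sum_z P z * G z.
Proof.
move=> hG; rewrite !big_prod; apply: eq_bigr => q _.
have Gd a a' b x : G (q, dpair a b, x) = G (q, dpair (i := i0) a' b, x).
  apply: hG => k ki; have -> : k = ~~ i0 by case: (k) (i0) ki => [] [].
  by rewrite !dpairE2.
rewrite !(big_dpair i0) exchange_big [RHS]exchange_big /=.
apply: eq_bigr => b _; rewrite exchange_big [RHS]exchange_big /=.
apply: eq_bigr => x _; rewrite /trivialize /=.
under eq_bigr do rewrite dpairE1 dpairE2 (Gd _ (d0 i0)) -mulrA mulrC.
rewrite sum_delta big_distrl /=; apply: eq_bigr => a _.
by rewrite (Gd _ a).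
Qed.

Hypothesis P_ge0 : forall z, 0 <= P z.

Lemma trivialize_joint_ge0 (w : Defs.space ch Q U) :
  0 <= joint_law trivialize w.
Proof.
rewrite mulr_ge0 //; last by apply: prodr_ge0 => i _; exact: (law_pmf _ _).1.
by rewrite mulr_ge0 // sumr_ge0.
Qed.

Lemma trivialize_support (w : Defs.space ch Q U) k :
  k = i0 -> joint_law trivialize w != 0 -> rvU k w = d0 k.
Proof.
move=> ->; rewrite /joint_law /trivialize !mulf_eq0 !negb_or.
by move=> /andP [/andP []]; rewrite pnatr_eq0 eqb0 negbK => /eqP.
Qed.

Lemma HY_trivialize_law r (S : {set 'I_(K ch r)}) (a b : bool) :
  (a -> r != i0) -> (b -> ~~ r != i0) -> HY trivialize r S a b = HY P r S a b.
Proof.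
move=> ha hb; apply: cond_entropy_eq_law => y c; rewrite !probE.
pose Cz (z : Q * aux U * inputs ch) := (opt a (z.1.2 r),
  ([ffun j => z.2 r (val j)] :
     {dffun forall j : {j : 'I_(K ch r) | j \in S}, inp ch r (val j)},
   opt b (z.1.2 (~~ r)), z.1.1)).
rewrite (sum_joint_law trivialize (i := r)
  (fun z y' => ((y' == y) && (Cz z == c))%:R)).
rewrite (sum_joint_law P (i := r) (fun z y' => ((y' == y) && (Cz z == c))%:R)).
rewrite (sum_trivialize (G := fun z => \sum_y0 cell_law z.2 y0 *
  ((y0 == y) && (Cz z == c))%:R)) // => q u u' x e.
suff -> : Cz (q, u, x) = Cz (q, u', x) by [].
rewrite /Cz /=; congr (_, (_, _, _)).
- by case: (a) ha => //= /(_ isT) /e ->.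
- by case: (b) hb => //= /(_ isT) /e ->.
Qed.

Lemma HY_trivialize_own S a b :
  HY trivialize i0 S a b = HY P i0 S false b.
Proof.
transitivity (HY trivialize i0 S false b); last first.
  by apply: HY_trivialize_law => // _; case: (i0).
case: a => //.
transitivity (cond_entropy (joint_law trivialize) (@rvY _ ch Q U i0)
  (fun w => (rvU i0 w, cvar S false b w))).
  apply: cond_entropy_equiv; first exact: trivialize_joint_ge0.
  move=> w w'; split=> [[eu ex eb eq]|[eu ex eb eq]].
    by congr (_, (_, (_, _, _))).
  by congr (Some _, (_, _, _)).
apply: (@cond_entropy_const _ _ _ trivialize_joint_ge0 _ _ _ _ _ _ (d0 i0)) => w.
exact: trivialize_support.
Qed.

Lemma HY_trivialize_other r S a b : ~~ r = i0 ->
  HY trivialize r S a b = HY P r S a false.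
Proof.
move=> ri; transitivity (HY trivialize r S a false); last first.
  by apply: HY_trivialize_law => // _; rewrite -ri; case: (r).
case: b => //.
transitivity (cond_entropy (joint_law trivialize) (@rvY _ ch Q U r)
  (fun w => (rvU (~~ r) w, cvar S a false w))).
  apply: cond_entropy_equiv; first exact: trivialize_joint_ge0.
  move=> w w'; split=> [[ea ex eb eq]|[eb ea ex eq]].
    by congr (_, (_, (_, _, _))).
  by congr (_, (_, Some _, _)).
apply: (@cond_entropy_const _ _ _ trivialize_joint_ge0 _ _ _ _ _ _ (d0 (~~ r))) => w.
exact: trivialize_support.
Qed.

End Trivialize.

(** * The two regions *)

Section Regions.
Context (R : realType) (ch : mac_ic_mac R) (r : rates ch).
Context (Q : finType) (U : cell -> finType) (P : Q * aux U * inputs ch -> R).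

(** The inequalities are stated once for a cell [i] and the other cell [j]: [ineqB] covers 1 and 3,
    [ineqAE] 2 and 4, [ineqAG] 5 and 6, [ineqEE] 7, [ineqAGE] 8 and 9. *)
Definition ineqB (i : cell) : Prop := forall O : {set 'I_(K ch i)},
  O != finset.set0 -> sum_rate r O <= fB P O.
Definition ineqAE (i j : cell) : Prop :=
  forall (S : {set 'I_(K ch i)}) (S' : {set 'I_(K ch j)}),
  user1 ch i \in S -> user1 ch j \in S' -> sum_rate r S <= fA P S + fE P S'.
Definition ineqAG (i j : cell) : Prop :=
  forall (S : {set 'I_(K ch i)}) (O : {set 'I_(K ch j)}),
  user1 ch i \in S -> O != finset.set0 ->
  sum_rate r S + sum_rate r O <= fA P S + fG P O.
Definition ineqEE (i j : cell) : Prop :=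
  forall (S : {set 'I_(K ch i)}) (S' : {set 'I_(K ch j)}),
  user1 ch i \in S -> user1 ch j \in S' ->
  sum_rate r S + sum_rate r S' <= fE P S + fE P S'.
Definition ineqAGE (i j : cell) : Prop :=
  forall (S O : {set 'I_(K ch i)}) (S' : {set 'I_(K ch j)}),
  user1 ch i \in S -> O != finset.set0 -> user1 ch j \in S' ->
  sum_rate r S + sum_rate r O + sum_rate r S' <= fA P S + fG P O + fE P S'.

Definition ineqs_c (i j : cell) : Prop :=
  [/\ ineqB i, ineqAG i j, ineqEE i j & ineqAGE i j].

Let setTn0 i : [set: 'I_(K ch i)]%SET != finset.set0.
Proof. by apply/set0Pn; exists (user1 ch i); rewrite inE. Qed.

Lemma Rc_ofP : Rc_of P r <-> nonneg_rates r /\ forall i, ineqs_c i (~~ i).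
Proof.
split=> [[r0 h]|[r0 h]]; split=> //.
  have u1 i : user1 ch i \in [set: 'I_(K ch i)]%SET by rewrite inE.
  case; split.
  - by move=> O On; have := h _ _ _ _ (u1 _) (setTn0 _) (u1 _) On; tauto.
  - move=> S O Su On; have := h _ _ _ _ (u1 _) On Su (setTn0 _); lra.
  - move=> S S' Su Su'; have := h _ _ _ _ Su' (setTn0 _) Su (setTn0 _); lra.
  - move=> S O S' Su On Su'; have := h _ _ _ _ Su' (setTn0 _) Su On; lra.
  - by move=> O On; have := h _ _ _ _ (u1 _) On (u1 _) (setTn0 _); tauto.
  - move=> S O Su On; have := h _ _ _ _ Su (setTn0 _) (u1 _) On; lra.
  - move=> S S' Su Su'; have := h _ _ _ _ Su (setTn0 _) Su' (setTn0 _); lra.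
  - move=> S O S' Su On Su'; have := h _ _ _ _ Su On Su' (setTn0 _); lra.
move=> S1 O1 S2 O2 u1 n1 u2 n2.
have [hB1 hAG1 hEE1 hAGE1] := h false; have [hB2 hAG2 hEE2 hAGE2] := h true.
have := hB1 _ n1; have := hB2 _ n2; have := hAG1 _ _ u1 n2.
have := hAG2 _ _ u2 n1; have := hEE1 _ _ u1 u2.
have := hAGE1 _ _ _ u1 n1 u2; have := hAGE2 _ _ _ u2 n2 u1.
by move=> *; do ! split; lra.
Qed.

Lemma Rin_ofP : Rin_of P r <-> Rc_of P r /\ forall i, ineqAE i (~~ i).
Proof.
split=> [[r0 h]|[[r0 h] h']].
  split; first by split=> // S1 O1 S2 O2 u1 n1 u2 n2; have := h _ _ _ _ u1 n1 u2 n2; tauto.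
  case=> S S' Su Su'; first by have := h _ _ _ _ Su' (setTn0 _) Su (setTn0 _); lra.
  by have := h _ _ _ _ Su (setTn0 _) Su' (setTn0 _); lra.
split=> // S1 O1 S2 O2 u1 n1 u2 n2; have := h _ _ _ _ u1 n1 u2 n2.
have := h' false _ _ u1 u2; have := h' true _ _ u2 u1; rewrite (addrC (fA P S2)).
tauto.
Qed.

End Regions.

Lemma sum_rate_ge0 (R : realType) (ch : mac_ic_mac R) (r : rates ch) i
    (S : {set 'I_(K ch i)}) : nonneg_rates r -> 0 <= sum_rate r S.
Proof. by move=> r0; apply: sumr_ge0 => j _; exact: r0. Qed.

(** Suppose R(S0) > A_{S0} + E_{S0'}. Making U_i constant raises the subtracted entropy at the other
    receiver [j] by at most E_{S0'}, and this is exactly what is gained when the violated inequality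
    is subtracted from [ineqAG] and [ineqAGE] at S0. *)
Lemma Rc_of_Rin (R : realType) (ch : mac_ic_mac R) (r : rates ch)
    (Q : finType) (U : cell -> finType) (P : Q * aux U * inputs ch -> R) :
  coding_dist P -> Rc_of P r -> Rin ch r.
Proof.
move=> cP Pr; have [Pr'|] := pselect (forall i, ineqAE r P i (~~ i)).
  by exists Q, U, P; split=> //; apply/Rin_ofP.
move=> /existsNP [i /existsNP [S0 /existsNP [S0' nh]]].
have uS0 : user1 ch i \in S0 by apply: contrapT => n; apply: nh => /n.
have uS0' : user1 ch (~~ i) \in S0' by apply: contrapT => n; apply: nh => _ /n.
have viol : fA P S0 + fE P S0' < sum_rate r S0.
  by rewrite ltNge; apply/negP => le; apply: nh.
have [pQ [pUX [pX [hQ hUX hX PE]]]] := cP.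
have P_ge0 := coding_dist_ge0 hQ hUX hX PE.
(* The alphabets are non-empty because they carry probability laws. *)
have U0 k : {u : U k | true}.
  apply: cid; have [q _] : exists q : Q, True.
    apply: contrapT => noq; have := hQ.2; rewrite big1; first lra.
    by move=> q; case: noq; exists q.
  apply: contrapT => nou; have := (hUX k q).2; rewrite big1; first lra.
  by move=> [u x] _; case: nou; exists u.
pose d0 k := sval (U0 k).
have cP' := trivialize_coding_dist i d0 cP.
exists Q, U, (trivialize P i d0); split=> //.
have [pQ' [pUX' [pX' [hQ' hUX' hX' PE']]]] := cP'.
move/Rc_ofP: Pr => [r0 h].
pose j := ~~ i.
have own (S : {set 'I_(K ch i)}) a b := @HY_trivialize_own _ _ _ _ P i d0 P_ge0 S a b.
have oth (S : {set 'I_(K ch j)}) a b :=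
  @HY_trivialize_other _ _ _ _ P i d0 P_ge0 j S a b (negbK i).
have fA'i S := fA_HY hQ' hUX' hX' PE' (i := i) S.
have fB'i S := fB_HY hQ' hUX' hX' PE' (i := i) S.
have fE'i S := fE_HY hQ' hUX' hX' PE' (i := i) S.
have fG'i S := fG_HY hQ' hUX' hX' PE' (i := i) S.
have fA'j S := fA_HY hQ' hUX' hX' PE' (i := j) S.
have fB'j S := fB_HY hQ' hUX' hX' PE' (i := j) S.
have fE'j S := fE_HY hQ' hUX' hX' PE' (i := j) S.
have fG'j S := fG_HY hQ' hUX' hX' PE' (i := j) S.
have fA_i S := fA_HY hQ hUX hX PE (i := i) S.
have fB_i S := fB_HY hQ hUX hX PE (i := i) S.
have fG_i S := fG_HY hQ hUX hX PE (i := i) S.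
have fE_j S := fE_HY hQ hUX hX PE (i := j) S.
have fG_j S := fG_HY hQ hUX hX PE (i := j) S.
have mono := HY_mono hQ hUX hX PE.
(* The left side is the new subtracted entropy at [j]; the right side is the first term of E_S. *)
have E0 (S : {set 'I_(K ch j)}) :
    HY P j [set: 'I_(K ch j)]%SET false false <= HY P j (~: S) true false.
  by rewrite -(HY_setT hQ hUX hX PE); apply: mono => //; exact: finset.subsetT.
have := viol; rewrite fA_i fE_j => viol'.
have [hB hAG _ hAGE] := h i.
have S0n : forall k (S : {set 'I_(K ch k)}), user1 ch k \in S -> S != finset.set0.
  by move=> k S u; apply/set0Pn; exists (user1 ch k).
have e0 := E0 S0'.
have tB : ineqB r (trivialize P i d0) i.
  by move=> O On; rewrite fB'i !own -fB_i; exact: hB.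
have tBj : ineqB r (trivialize P i d0) j.
  move=> O On; rewrite fB'j !oth; have := hAG _ _ uS0 On.
  rewrite fA_i fG_j; lra.
have tG : forall (O : {set 'I_(K ch i)}) (S : {set 'I_(K ch j)}),
    O != finset.set0 -> user1 ch j \in S -> sum_rate r O + sum_rate r S <=
    fG (trivialize P i d0) O + fA (trivialize P i d0) S.
  move=> O S On uS; rewrite fG'i fA'j !own !oth; have := hAGE _ _ _ uS0 On uS.
  rewrite fA_i fG_i fE_j; lra.
(* With U_i constant, E = A and G = B at receiver [j], while E = G and A = B at receiver [i]. The
   remaining inequalities then come from adding [tB], [tBj] and [tG], or from one of them by
   nonnegativity. *)
have EAj (S : {set 'I_(K ch j)}) : fE (trivialize P i d0) S = fA (trivialize P i d0) S.
  by rewrite fE'j fA'j !oth.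
have EGi (S : {set 'I_(K ch i)}) : fE (trivialize P i d0) S = fG (trivialize P i d0) S.
  by rewrite fE'i fG'i !own.
have ABi (S : {set 'I_(K ch i)}) : fA (trivialize P i d0) S = fB (trivialize P i d0) S.
  by rewrite fA'i fB'i !own.
have BGj (S : {set 'I_(K ch j)}) : fG (trivialize P i d0) S = fB (trivialize P i d0) S.
  by rewrite fG'j fB'j !oth.
have Aj0 (S : {set 'I_(K ch j)}) : 0 <= fA (trivialize P i d0) S.
  by rewrite fA'j !oth subr_ge0.
have sr0 k (S : {set 'I_(K ch k)}) : 0 <= sum_rate r S by exact: sum_rate_ge0.
have ti : ineqs_c r (trivialize P i d0) i j.
  split=> //.
  - move=> S O uS On; have := tB _ (S0n _ _ uS); have := tBj _ On.
    by rewrite ABi BGj; lra.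
  - move=> S S' uS uS'; have := tG _ _ (S0n _ _ uS) uS'.
    by rewrite EGi EAj.
  - move=> S O S' uS On uS'; have := tB _ (S0n _ _ uS); have := tG _ _ On uS'.
    by rewrite ABi EAj; lra.
have tj : ineqs_c r (trivialize P i d0) j i.
  split=> //.
  - by move=> S O uS On; have := tG _ _ On uS; lra.
  - move=> S S' uS uS'; have := tG _ _ (S0n _ _ uS') uS.
    by rewrite EGi EAj; lra.
  - move=> S O S' uS On uS'; have := tBj _ On; have := tG _ _ (S0n _ _ uS') uS.
    by rewrite EGi BGj; lra.
have ai : ineqAE r (trivialize P i d0) i j.
  move=> S S' uS uS'; have := tB _ (S0n _ _ uS); have := Aj0 S'.
  by rewrite ABi EAj; lra.
have aj : ineqAE r (trivialize P i d0) j i.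
  move=> S S' uS uS'; have := tG _ _ (S0n _ _ uS') uS; have := sr0 _ S'.
  by rewrite EGi; lra.
apply/Rin_ofP; split; first apply/Rc_ofP; first split=> //.
  by move: ti tj; rewrite /j; case: (i) => ? ? [].
by move: ai aj; rewrite /j; case: (i) => ? ? [].
Qed.

(** * Rate splitting *)

Lemma finite_lub (R : realType) (T : finType) (A : pred T) (F : T -> R) (c : R) :
  exists b, [/\ c <= b, forall x, A x -> F x <= b &
    forall u, c <= u -> (forall x, A x -> F x <= u) -> b <= u].
Proof.
exists (\big[Num.max/c]_(x | A x) F x); split.
- exact: bigmax_ge_id.
- by move=> x Ax; exact: le_bigmax_cond.
- by move=> u cu Fu; apply: bigmax_le.
Qed.

Lemma finite_glb (R : realType) (T : finType) (A : pred T) (F : T -> R) (c : R) :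
  exists b, [/\ b <= c, forall x, A x -> b <= F x &
    forall u, u <= c -> (forall x, A x -> u <= F x) -> u <= b].
Proof.
exists (\big[Num.min/c]_(x | A x) F x); split.
- exact: bigmin_le_id.
- by move=> x Ax; exact: bigmin_le_cond.
- by move=> u cu Fu; apply: le_bigmin.
Qed.

Section RateSplitting.
Context (R : realType) (ch : mac_ic_mac R) (Q : finType) (U : cell -> finType).

(* The bound on the rate of an error event at receiver [i] in which the messages
   of the users in [S] are wrong: [p] says that the common part of the message
   of user [i.1] is nevertheless correct, [b] that the common message of the
   other cell is wrong. *)
Definition fval (P : Q * aux U * inputs ch -> R) (i : cell)
    (S : {set 'I_(K ch i)}) (p b : bool) : R :=
  if p then (if b then fE P S else fA P S) else (if b then fG P S else fB P S).

Context (P : Q * aux U * inputs ch -> R).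
Context (pQ : Q -> R) (pUX : forall i, Q -> U i * inp ch i (user1 ch i) -> R).
Context (pX : forall i (j : 'I_(K ch i)), Q -> inp ch i j -> R).
Arguments pUX : clear implicits.
Arguments pX : clear implicits.
Hypothesis pQ_pmf : is_pmf pQ.
Hypothesis pUX_pmf : forall i q, is_pmf (pUX i q).
Hypothesis pX_pmf : forall i j q, j != user1 ch i -> is_pmf (pX i j q).
Hypothesis PE : forall q u x, P (q, u, x) =
  pQ q * \prod_(i : cell) (pUX i q (u i, x i (user1 ch i)) *
                           \prod_(j | j != user1 ch i) pX i j q (x i j)).

Let mono := HY_mono pQ_pmf pUX_pmf pX_pmf PE.
Let markov := HY_markov pQ_pmf pUX_pmf pX_pmf PE.

Lemma fval_HY i S p b : fval P S p b =
  HY P i (~: S) p (~~ b) - HY P i [set: 'I_(K ch i)]%SET false true.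
Proof.
case: p b => [] [] /=; rewrite /fval.
- exact: (fE_HY pQ_pmf pUX_pmf pX_pmf PE).
- exact: (fA_HY pQ_pmf pUX_pmf pX_pmf PE).
- exact: (fG_HY pQ_pmf pUX_pmf pX_pmf PE).
- exact: (fB_HY pQ_pmf pUX_pmf pX_pmf PE).
Qed.

Lemma fval_wrong_le i (S : {set 'I_(K ch i)}) p : fval P S p false <= fval P S p true.
Proof. by rewrite !fval_HY lerD2r; apply: mono => //; case: p. Qed.

Lemma fval_ge0 i (S : {set 'I_(K ch i)}) : 0 <= fval P S true false.
Proof.
rewrite fval_HY subr_ge0 -(HY_setT pQ_pmf pUX_pmf pX_pmf PE).
by apply: mono => //; exact: finset.subsetT.
Qed.

(** Removing i.1 from [S] moves X_{i.1} into the conditioning, where U_i adds no information; so the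
    left side conditions on more than the right side does. *)
Lemma fval_private_ge i (S : {set 'I_(K ch i)}) b : user1 ch i \in S ->
  fval P (S :\ user1 ch i) false b <= fval P S true b.
Proof.
move=> uS; rewrite !fval_HY lerD2r -markov ?finset.inE ?eqxx //.
by apply: mono => //; rewrite finset.setCS finset.subD1set.
Qed.

Lemma sum_rateD1 (r : rates ch) i (S : {set 'I_(K ch i)}) : user1 ch i \in S ->
  sum_rate r S = rate r (user1 ch i) + sum_rate r (S :\ user1 ch i).
Proof. exact: finset.big_setD1. Qed.

(* Fourier-Motzkin elimination of the rates [t i] of the common messages. *)
Lemma rate_splitting (r : rates ch) : Rin_of P r ->
  exists t : cell -> R,
    (forall i, 0 <= t i <= rate r (user1 ch i)) /\
    forall i (S : {set 'I_(K ch i)}) (p b : bool),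
      S != finset.set0 -> (p -> user1 ch i \in S) ->
      sum_rate r S - p%:R * t i + b%:R * t (~~ i) <= fval P S p b.
Proof.
move=> /Rin_ofP [/Rc_ofP [r0 hc] hAE].
have S0n i (S : {set 'I_(K ch i)}) : user1 ch i \in S -> S != finset.set0.
  by move=> u; apply/set0Pn; exists (user1 ch i).
have uT i : user1 ch i \in [set: 'I_(K ch i)]%SET by rewrite inE.
have priv i (S : {set 'I_(K ch i)}) : user1 ch i \in S ->
    sum_rate r S - rate r (user1 ch i) <= fA P S.
  move=> uS; rewrite (sum_rateD1 _ uS) addrC addKr.
  have [->|ne] := eqVneq (S :\ user1 ch i) finset.set0.
    by rewrite /sum_rate finset.big_set0; exact: fval_ge0.
  apply: le_trans (fval_private_ge false uS).
  by have [hB _ _ _] := hc i; exact: hB.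
(* Inequalities 2 and 4 are needed here only, for S' = {i'.1}; for larger S' inequalities 5 and 6
   suffice. *)
have privE i (S : {set 'I_(K ch i)}) (S' : {set 'I_(K ch (~~ i))}) :
    user1 ch i \in S -> user1 ch (~~ i) \in S' ->
    sum_rate r S + sum_rate r S' - rate r (user1 ch (~~ i)) <= fA P S + fE P S'.
  move=> uS uS'; rewrite (sum_rateD1 _ uS').
  have [->|ne] := eqVneq (S' :\ user1 ch (~~ i)) finset.set0.
    by rewrite /sum_rate finset.big_set0 addr0 addrK; exact: hAE.
  have := fval_private_ge true uS'; rewrite /fval /=.
  by have [_ hAG _ _] := hc i; have := hAG _ _ uS ne; lra.
have AE i (S : {set 'I_(K ch i)}) : fA P S <= fE P S := fval_wrong_le S true.
have BG i (S : {set 'I_(K ch i)}) : fB P S <= fG P S := fval_wrong_le S false.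
(* The constraints on [t] read lo i <= t i <= hi i and t (~~ i) <= t i + di i. The default values in
   [lb] and [ub] are the constraints 0 <= t i <= R_{i.1}; the one in [df] belongs to the family
   already. *)
have lb i := finite_lub [pred S : {set 'I_(K ch i)} | user1 ch i \in S]
  (fun S => sum_rate r S - fA P S) 0.
have ub i := finite_glb [pred O : {set 'I_(K ch (~~ i))} | O != finset.set0]
  (fun O => fG P O - sum_rate r O) (rate r (user1 ch i)).
have df i := finite_glb [pred S : {set 'I_(K ch i)} | user1 ch i \in S]
  (fun S => fE P S - sum_rate r S)
  (fE P [set: 'I_(K ch i)]%SET - sum_rate r [set: 'I_(K ch i)]%SET).
pose lo i := sval (cid (lb i)); pose hi i := sval (cid (ub i)).
pose di i := sval (cid (df i)).
have lo0 i : 0 <= lo i by case: (svalP (cid (lb i))).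
have loS i (S : {set 'I_(K ch i)}) : user1 ch i \in S ->
  sum_rate r S - fA P S <= lo i by case: (svalP (cid (lb i))) => _ + _; exact.
have lo_le i u : 0 <= u -> (forall S : {set 'I_(K ch i)}, user1 ch i \in S ->
  sum_rate r S - fA P S <= u) -> lo i <= u.
  by case: (svalP (cid (lb i))) => _ _; exact.
have hir i : hi i <= rate r (user1 ch i) by case: (svalP (cid (ub i))).
have hiO i (O : {set 'I_(K ch (~~ i))}) : O != finset.set0 ->
  hi i <= fG P O - sum_rate r O by case: (svalP (cid (ub i))) => _ + _; exact.
have le_hi i u : u <= rate r (user1 ch i) ->
  (forall O : {set 'I_(K ch (~~ i))}, O != finset.set0 ->
  u <= fG P O - sum_rate r O) -> u <= hi i.
  by case: (svalP (cid (ub i))) => _ _; exact.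
have diS i (S : {set 'I_(K ch i)}) : user1 ch i \in S ->
  di i <= fE P S - sum_rate r S by case: (svalP (cid (df i))) => _ + _; exact.
have le_di i u : (forall S : {set 'I_(K ch i)}, user1 ch i \in S ->
  u <= fE P S - sum_rate r S) -> u <= di i.
  by case: (svalP (cid (df i))) => _ _ h hu; apply: h => //; exact: hu.
have lohi i : lo i <= hi i.
  have [_ hAG _ _] := hc i; have [hB _ _ _] := hc (~~ i).
  apply: lo_le => [|S uS]; apply: le_hi => [|O On].
  - exact: r0.
  - by have := hB _ On; have := BG _ O; lra.
  - by have := priv _ _ uS; lra.
  - by have := hAG _ _ uS On; lra.
have didi : 0 <= di false + di true.
  rewrite -[di false]opprK addrC subr_ge0; apply: (le_di) => S uS.
  rewrite lerNl opprB; apply: le_di => S' uS'.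
  by have [_ _ hEE _] := hc false; have := hEE _ _ uS' uS; lra.
have lohd i : lo i <= hi (~~ i) + di (~~ i).
  rewrite -lerBlDr; apply: le_hi => [|O On].
    rewrite lerBlDr addrC -lerBlDr; apply: le_di => S' uS'.
    rewrite lerBlDr; apply: lo_le => [|S uS].
      by have := priv _ _ uS'; have := AE _ S'; lra.
    by have := privE _ _ _ uS uS'; lra.
  rewrite lerBlDr addrC -lerBlDr; apply: le_di => S' uS'.
  rewrite lerBlDr; move: O On; rewrite negbK => O On.
  have [_ hAG' _ _] := hc (~~ i); have := hAG'; rewrite negbK => hAG.
  have [_ _ _ hAGE] := hc i.
  apply: lo_le => [|S uS].
    by have := hAG _ _ uS' On; have := AE _ S'; lra.
  by have := hAGE _ _ _ uS On uS'; lra.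
(* The least solution: [t0] must leave room for t1 >= lo true under t1 <= t0 + di false, and then
   [t1] is taken as small as t0 <= t1 + di true permits. *)
pose t0 := Num.max (lo false) (lo true - di false).
pose t1 := Num.max (lo true) (t0 - di true).
have lohd0 := lohd false; have lohd1 := lohd true; rewrite /= in lohd0 lohd1.
have t0lo : lo false <= t0 by rewrite le_max lexx.
have t0lo' : lo true - di false <= t0 by rewrite le_max lexx orbT.
have t1lo : lo true <= t1 by rewrite le_max lexx.
have t1lo' : t0 - di true <= t1 by rewrite le_max lexx orbT.
have t0hi : t0 <= hi false by rewrite ge_max lohi /=; lra.
have t0hi' : t0 <= hi true + di true by rewrite ge_max lohd0 /=; have := lohi true; lra.
have t1hi : t1 <= hi true by rewrite ge_max lohi /=; lra.
have t10 : t1 <= t0 + di false by rewrite ge_max; apply/andP; split; lra.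
pose t (i : cell) := if i then t1 else t0.
have tlo i : lo i <= t i by case: i.
have thi i : t i <= hi i by case: i.
have td i : t (~~ i) <= t i + di i by case: i => /=; lra.
exists t; split=> [i|i S p b Sn pS].
  by rewrite (le_trans (lo0 i) (tlo i)) (le_trans (thi i)).
have [hB _ _ _] := hc i; have := hB _ Sn.
have G : sum_rate r S + t (~~ i) <= fG P S.
  have := thi (~~ i); have := @hiO (~~ i); rewrite negbK => /(_ S Sn); lra.
case: p pS => [/(_ isT) uS|_]; case: b; rewrite /fval ?mulr1n ?mulr0n.
- by have := diS _ _ uS; have := td i; lra.
- by have := loS _ _ uS; have := tlo i; lra.
- by move: G; lra.
- by lra.
Qed.

End RateSplitting.

(** * Independent representation of the coding distribution *)

Section Virtual.
Context (R : realType) (ch : mac_ic_mac R) (Q : finType) (U : cell -> finType).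
Context (P : Q * aux U * inputs ch -> R).
Context (pQ : Q -> R) (pUX : forall i, Q -> U i * inp ch i (user1 ch i) -> R).
Context (pX : forall i (j : 'I_(K ch i)), Q -> inp ch i j -> R).
Arguments pUX : clear implicits.
Arguments pX : clear implicits.
Hypothesis pQ_pmf : is_pmf pQ.
Hypothesis pUX_pmf : forall i q, is_pmf (pUX i q).
Hypothesis pX_pmf : forall i j q, j != user1 ch i -> is_pmf (pX i j q).
Hypothesis PE : forall q u x, P (q, u, x) =
  pQ q * \prod_(i : cell) (pUX i q (u i, x i (user1 ch i)) *
                           \prod_(j | j != user1 ch i) pX i j q (x i j)).

Let Z : finType := (Q * aux U * inputs ch)%type.

Definition pU i q u : R := \sum_x pUX i q (u, x).

(* The conditional law of X_{i.1} given (Q, U_i); where the latter has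
   probability 0, and without U_i, it is replaced by the law of X_{i.1} given Q. *)
Definition pX1 i q (ou : option (U i)) (x : inp ch i (user1 ch i)) : R :=
  if ou is Some u then
    if pU q u == 0 then \sum_u' pUX i q (u', x) else pUX i q (u, x) / pU q u
  else \sum_u' pUX i q (u', x).

(** The match on the equality proof transports [pX1], which is typed at user i.1, to the user
    [j]. *)
Definition kX i (j : 'I_(K ch i)) (q : Q) (ou : option (U i)) : inp ch i j -> R :=
  match user1 ch i =P j with
  | ReflectT e => match e in _ = j' return inp ch i j' -> R with
                  | erefl => pX1 q ou
                  end
  | ReflectF _ => pX i j q
  end.

Lemma kX_user1 i q ou : kX (j := user1 ch i) q ou = pX1 q ou.
Proof. by rewrite /kX; case: eqP => // e; rewrite (eq_irrelevance e erefl). Qed.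

Lemma kX_other i (j : 'I_(K ch i)) q ou : j != user1 ch i -> kX q ou = pX i j q.
Proof. by move=> ji; rewrite /kX; case: eqP => // e; rewrite e eqxx in ji. Qed.

Lemma pU_pmf i q : is_pmf (@pU i q).
Proof.
have [ge0 s1] := pUX_pmf i q; split=> [u|]; first exact: sumr_ge0.
by rewrite -s1 big_prod.
Qed.

Lemma pX1_pmf i q (ou : option (U i)) : is_pmf (pX1 q ou).
Proof.
have [ge0 s1] := pUX_pmf i q.
have mpmf : is_pmf (fun x => \sum_u' pUX i q (u', x)).
  split=> [x|]; first exact: sumr_ge0.
  by rewrite exchange_big -s1 big_prod.
case: ou => [u|//]; rewrite /pX1; have [//|ne] := eqVneq (pU q u) 0.
split=> [x|]; first by rewrite divr_ge0 //; case: (pU_pmf i q).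
by rewrite -big_distrl /= divff.
Qed.

Lemma kX_pmf i (j : 'I_(K ch i)) q ou : is_pmf (kX (j := j) q ou).
Proof.
have [->|ne] := eqVneq j (user1 ch i); first by rewrite kX_user1; exact: pX1_pmf.
by rewrite kX_other //; exact: pX_pmf.
Qed.

Lemma pU_kX i q u x : pU q u * kX q (Some u) x = pUX i q (u, x).
Proof.
rewrite kX_user1 /pX1; have [e|ne] := eqVneq; last by rewrite mulrC divfK.
rewrite e mul0r; apply/esym/eqP; move/eqP: e.
by rewrite psumr_eq0 => [/allP/(_ x (mem_index_enum _))|? _]; last case: (pUX_pmf i q).
Qed.

(* Independent virtual users: time sharing, the common layer of each cell, and
   every user; each letter of the last two is a random function of what its law
   depends on. *)
Definition vuser : finType := option {i : cell & option 'I_(K ch i)}.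
Definition vu (i : cell) : vuser := Some (existT _ i None).
Definition vx (i : cell) (j : 'I_(K ch i)) : vuser := Some (existT _ i (Some j)).

Definition valph (k : vuser) : finType :=
  match k with
  | None => Q
  | Some (existT i None) => {ffun Q -> U i}
  | Some (existT i (Some j)) => {ffun Q * option (U i) -> inp ch i j}
  end.

Definition vlaw (k : vuser) : valph k -> R :=
  match k return valph k -> R with
  | None => pQ
  | Some (existT i None) => fun h => \prod_q pU q (h q)
  | Some (existT i (Some j)) => fun h => \prod_a kX a.1 a.2 (h a)
  end.

Lemma vlaw_ge0 k (h : valph k) : 0 <= vlaw h.
Proof.
case: k h => [[i [j|]]|] h /=; last by case: pQ_pmf.
  by apply: prodr_ge0 => a _; case: (kX_pmf j a.1 a.2).
by apply: prodr_ge0 => q _; case: (pU_pmf i q).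
Qed.

Lemma vlaw_sum1 k : \sum_(h : valph k) vlaw h = 1.
Proof.
case: k => [[i [j|]]|] /=; last by case: pQ_pmf.
  rewrite -(bigA_distr_bigA (fun a => kX (j := j) a.1 a.2)) big1 // => a _.
  by case: (kX_pmf j a.1 a.2).
rewrite -(bigA_distr_bigA (fun q => @pU i q)) big1 // => q _.
by case: (pU_pmf i q).
Qed.

Definition vsub (i : cell) (j : 'I_(K ch i)) (u : U i) : option (U i) :=
  if j == user1 ch i then Some u else None.

(** The functions are evaluated in causal order: Q, then U_i at Q, then X_{i.j} at Q and, for i.1
    alone, at U_i. Other users read their function at [None]. *)
Definition ev (v : vec valph) : Z :=
  let q : Q := v None in
  let u (i : cell) : U i := (v (vu i) : {ffun Q -> U i}) q in
  (q, [ffun i => u i],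
   [ffun i => [ffun j => (v (vx j) : {ffun Q * option (U i) -> inp ch i j})
                           (q, vsub j (u i))]]).

Arguments ev : simpl never.

Lemma ffun_point_law (A B : finType) (p : A -> B -> R) (a : A) (b : B) :
  (forall a, \sum_b p a b = 1) ->
  \sum_(h : {ffun A -> B}) (\prod_a' p a' (h a')) * (h a == b)%:R = p a b.
Proof.
move=> p1; transitivity (\sum_(h : {ffun A -> B}) \prod_a' (p a' (h a') *
    (if a' == a then (h a' == b)%:R else 1))).
  apply: eq_bigr => h _; rewrite big_split /=; congr (_ * _).
  by rewrite (bigD1 a) //= eqxx big1 ?mulr1 // => a' /negbTE ->.
rewrite -(bigA_distr_bigA (fun a' b' => p a' b' *
    (if a' == a then (b' == b)%:R else 1))) (bigD1 a) //= eqxx sum_delta.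
rewrite big1 ?mulr1 // => a' /negbTE ->.
by under eq_bigr do rewrite mulr1.
Qed.

Lemma prod_vuser (F : vuser -> R) :
  \prod_k F k = F None * \prod_i (F (vu i) * \prod_(j : 'I_(K ch i)) F (vx j)).
Proof.
have big_opt (T : finType) (G : option T -> R) :
    \prod_k G k = G None * \prod_k G (Some k).
  rewrite (bigD1 None) //=; congr (_ * _).
  rewrite (reindex_omap some id) //=; last by case.
  by apply: eq_bigl => k; rewrite /= eqxx.
rewrite big_opt; congr (_ * _).
transitivity (\prod_(i : cell) \prod_(o : option 'I_(K ch i)) F (Some (existT _ i o))).
  by rewrite sig_big_dep; apply: eq_bigr => -[].
by apply: eq_bigr => i _; rewrite big_opt.
Qed.

(** For a fixed target the arguments of all the functions are fixed too, so the event is an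
    intersection of the events [G k], one per virtual user, and its probability is a product. *)
Lemma ev_point_law z : \sum_v pv vlaw v * (ev v == z)%:R = P z.
Proof.
case: z => [[q u] x].
pose G (k : vuser) : valph k -> bool :=
  match k return valph k -> bool with
  | None => fun h => h == q
  | Some (existT i None) => fun h => h q == u i
  | Some (existT i (Some j)) => fun h => h (q, vsub j (u i)) == x i j
  end.
have evE v : (ev v == (q, u, x)) = [forall k, G k (v k)].
  apply/eqP/forallP => [[eq /ffunP eu /ffunP ex]|h].
    case=> [[i [j|]]|] /=.
    - have := ex i => /ffunP/(_ j); rewrite !ffunE => <-.
      by have := eu i; rewrite ffunE eq => <-.
    - by have := eu i; rewrite ffunE eq => <-.
    - by rewrite eq.
  have eq := eqP (h None); rewrite /= in eq.
  have eu i : (v (vu i) : {ffun Q -> U i}) q = u i := eqP (h (vu i)).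
  have ex i j : (v (vx j) : {ffun Q * option (U i) -> inp ch i j})
     (q, vsub j (u i)) = x i j := eqP (h (vx j)).
  rewrite /ev eq; congr (_, _, _); apply/ffunP => i; rewrite ffunE ?eu //.
  by apply/ffunP => j; rewrite ffunE ex.
under eq_bigr do rewrite evE natr_forall -big_split /=.
rewrite (big_dffun_distr (fun k (h : valph k) => vlaw h * (G k h)%:R)).
rewrite prod_vuser PE /=; congr (_ * _); first by rewrite sum_delta.
apply: eq_bigr => i _.
rewrite (@ffun_point_law _ _ (fun q => @pU i q)) => [|q']; last by case: (pU_pmf i q').
rewrite (eq_bigr (fun j => kX q (vsub j (u i)) (x i j))) => [|j _]; last first.
  rewrite (@ffun_point_law _ _ (fun a => kX (j := j) a.1 a.2)) //= => a.
  by case: (kX_pmf j a.1 a.2).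
rewrite (bigD1 (user1 ch i)) //= mulrA /vsub eqxx pU_kX; congr (_ * _).
by apply: eq_bigr => j ne; rewrite (negbTE ne) kX_other.
Qed.

Lemma ev_law (F : Z -> R) : \sum_v pv vlaw v * F (ev v) = \sum_z P z * F z.
Proof.
rewrite (sum_pushforward _ ev); apply: eq_bigr => z _.
by rewrite ev_point_law mulrC.
Qed.

Lemma prob_joint_ev i (E : Z -> out ch i -> bool) :
  prob (joint_law P) (fun w : Defs.space ch Q U => E w.1 (w.2 i)) =
  \sum_v pv vlaw v * \sum_y cell_law (ev v).2 y * (E (ev v) y)%:R.
Proof.
rewrite probE (sum_joint_law P (i := i) (fun z y => (E z y)%:R)).
by rewrite (ev_law (fun z => \sum_y cell_law z.2 y * (E z y)%:R)).
Qed.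

Section Ratio.
Context (i : cell) (TA TC : finType) (A : Z -> TA) (C : Z -> TC).

Definition zratio (z : Z) (y : out ch i) : R :=
  cmi_ratio (joint_law P) (fun w : Defs.space ch Q U => A w.1)
    (@rvY _ ch Q U i) (fun w => C w.1) (A z) y (C z).

Context (T : pred vuser).
Hypothesis C_mix : forall v v', C (ev (mix T v v')) = C (ev v).
Hypothesis A_mix : forall v1 v2 v', C (ev v1) = C (ev v2) ->
  A (ev (mix T v1 v')) = A (ev (mix T v2 v')).

Let J := joint_law P.
Let pac a c := prob J (fun w : Defs.space ch Q U => (A w.1 == a) && (C w.1 == c)).
Let pbc (b : out ch i) c := prob J (fun w : Defs.space ch Q U =>
  (@rvY _ ch Q U i w == b) && (C w.1 == c)).
Let pc c := prob J (fun w : Defs.space ch Q U => C w.1 == c).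
Let pabc a (b : out ch i) c := prob J (fun w : Defs.space ch Q U =>
  [&& A w.1 == a, @rvY _ ch Q U i w == b & C w.1 == c]).
Let pvv v v' : R := pv vlaw v * pv vlaw v'.
(** The joint law of [A] on a competing word, the output caused by the sent word, and [C], on which
    both words agree. *)
Let wr a (b : out ch i) c := \sum_v \sum_v' pvv v v' * \sum_y cell_law (ev v).2 y *
  [&& A (ev (mix T v v')) == a, y == b & C (ev v) == c]%:R.

Let J_ge0 w : 0 <= J w.
Proof. exact: (joint_law_ge0 pQ_pmf pUX_pmf pX_pmf PE). Qed.

Let sum_y_delta v (b : out ch i) (c : bool) :
  \sum_y cell_law (ev v).2 y * ((y == b) && c)%:R = cell_law (ev v).2 b * c%:R.
Proof.
rewrite -(sum_delta (fun y => cell_law (ev v).2 y * c%:R) b).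
by apply: eq_bigr => y _; rewrite -mulnb natrM mulrA mulrAC.
Qed.

Let sum_y1 v (c : bool) :
  \sum_y cell_law (i := i) (ev v).2 y * c%:R = c%:R.
Proof.
by rewrite -big_distrl /= (cell_law_pmf i _).2 mul1r.
Qed.

Let pcE c : pc c = \sum_v pv vlaw v * (C (ev v) == c)%:R.
Proof.
rewrite /pc (prob_joint_ev (i := i) (fun z _ => C z == c)).
by apply: eq_bigr => v _; rewrite sum_y1.
Qed.

Let pacE a c : pac a c = \sum_v pv vlaw v * ((A (ev v) == a) && (C (ev v) == c))%:R.
Proof.
rewrite /pac (prob_joint_ev (i := i) (fun z _ => (A z == a) && (C z == c))).
by apply: eq_bigr => v _; rewrite sum_y1.
Qed.

Let pbcE b c : pbc b c =
  \sum_v pv vlaw v * (cell_law (ev v).2 b * (C (ev v) == c)%:R).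
Proof.
rewrite /pbc (prob_joint_ev (i := i) (fun z y => (y == b) && (C z == c))).
by apply: eq_bigr => v _; rewrite sum_y_delta.
Qed.

(** Conditional independence given [C]: by [A_mix] the competing [A] depends on the sent word only
    through [C], and otherwise on the fresh coordinates, which do not affect the output. *)
Let wr_indep a b c : wr a b c * pc c = pac a c * pbc b c.
Proof.
case: (pickP (fun v => C (ev v) == c)) => [v0 /eqP Cv0|nC]; last first.
  rewrite pcE big1 ?mulr0 => [|v _]; last by rewrite nC mulr0.
  by rewrite pacE big1 ?mul0r // => v _; rewrite nC andbF mulr0.
pose k := \sum_v' pv vlaw v' * (A (ev (mix T v0 v')) == a)%:R.
have Amix v v' : C (ev v) = c -> A (ev (mix T v v')) = A (ev (mix T v0 v')).
  by move=> e; apply: A_mix; rewrite e Cv0.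
have wrE : wr a b c = k * pbc b c.
  rewrite pbcE big_distrr /=; apply: eq_bigr => v _.
  rewrite big_distrl /=; apply: eq_bigr => v' _.
  rewrite (eq_bigr (fun y => cell_law (ev v).2 y * ((y == b) &&
    ((A (ev (mix T v v')) == a) && (C (ev v) == c)))%:R)) => [|y _]; last first.
    by congr (_ * (_ : bool)%:R); rewrite andbCA.
  rewrite sum_y_delta /pvv; have [e|ne] := eqVneq (C (ev v)) c.
    by rewrite andbT Amix // mulr1n; ring.
  by rewrite andbF !mulr0.
have pacE' : pac a c = k * pc c.
  rewrite pacE pcE -(mix_law vlaw_sum1 T (fun v => ((A (ev v) == a) && (C (ev v) == c))%:R)).
  rewrite big_distrr /=; apply: eq_bigr => v _.
  rewrite big_distrl /=; apply: eq_bigr => v' _.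
  rewrite C_mix; have [e|ne] := eqVneq (C (ev v)) c; last by rewrite andbF !mulr0.
  by rewrite andbT Amix // mulr1n; ring.
by rewrite wrE pacE'; ring.
Qed.

(** By [wr_indep] the wrong triple has probability pac * pbc / pc, which cancels the ratio and
    leaves [pabc], of total mass 1. Where a denominator vanishes, the ratio or its numerator is
    0. *)
Lemma wrong_ratio_le1 :
  \sum_v \sum_v' pv vlaw v * pv vlaw v' *
    \sum_y cell_law (ev v).2 y * zratio (ev (mix T v v')) y <= 1.
Proof.
pose r a (b : out ch i) c := pabc a b c * pc c / (pac a c * pbc b c).
have -> : \sum_v \sum_v' pv vlaw v * pv vlaw v' *
    \sum_y cell_law (ev v).2 y * zratio (ev (mix T v v')) y =
  \sum_a \sum_b \sum_c r a b c * wr a b c.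
  pose mu (s : vec valph * vec valph * out ch i) :=
    pvv s.1.1 s.1.2 * cell_law (ev s.1.1).2 s.2.
  pose f (s : vec valph * vec valph * out ch i) :=
    (A (ev (mix T s.1.1 s.1.2)), s.2, C (ev s.1.1)).
  pose F (abc : TA * out ch i * TC) := r abc.1.1 abc.1.2 abc.2.
  transitivity (\sum_s mu s * F (f s)).
    rewrite !big_prod /=; apply: eq_bigr => v _; apply: eq_bigr => v' _.
    rewrite big_distrr /=; apply: eq_bigr => y _.
    by rewrite mulrA /zratio C_mix.
  rewrite sum_pushforward.
  rewrite !big_prod /=; apply: eq_bigr => a _; apply: eq_bigr => b _.
  apply: eq_bigr => c _; congr (_ * _); rewrite !big_prod /wr.
  apply: eq_bigr => v _; apply: eq_bigr => v' _.
  rewrite big_distrr /=; apply: eq_bigr => y _.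
  by rewrite /mu /f /= !xpair_eqE -andbA mulrA.
have -> : 1 = \sum_a \sum_b \sum_c pabc a b c.
  have := sum_prob J (fun w : Defs.space ch Q U => (A w.1, @rvY _ ch Q U i w, C w.1))
    (fun=> 1).
  under [in X in _ = X -> _]eq_bigr do rewrite mulr1.
  have -> : \sum_w J w = 1.
    have := sum_joint_law P (i := i) (fun _ _ => 1).
    under eq_bigr do rewrite mulr1; move=> ->.
    rewrite -(ev_law (fun z => \sum_y cell_law z.2 y * 1)).
    rewrite -[RHS](sum_pv vlaw_sum1); apply: eq_bigr => v _.
    under eq_bigr do rewrite mulr1.
    by rewrite (cell_law_pmf i _).2 mulr1.
  move=> <-; rewrite !big_prod; apply: eq_bigr => a _; apply: eq_bigr => b _.
  apply: eq_bigr => c _; rewrite mulr1; apply: eq_bigl => w.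
  by rewrite !xpair_eqE andbA.
apply: ler_sum => a _; apply: ler_sum => b _; apply: ler_sum => c _.
have pabc0 : 0 <= pabc a b c by exact: prob_ge0.
have [e|ne] := eqVneq (pac a c * pbc b c) 0.
  by rewrite /r e invr0 mulr0 mul0r.
have [e|nc] := eqVneq (pc c) 0.
  by rewrite /r e mulr0 !mul0r.
have wrE : wr a b c = pac a c * pbc b c / pc c by rewrite -wr_indep mulfK.
rewrite wrE /r.
move: ne; rewrite mulf_eq0 negb_or => /andP [na nb].
by rewrite le_eqVlt; apply/orP; left; apply/eqP; field; rewrite na nb nc.
Qed.

End Ratio.

Definition zX (i : cell) (S : {set 'I_(K ch i)}) (z : Z) :
    {dffun forall j : {j : 'I_(K ch i) | j \in S}, inp ch i (val j)} :=
  [ffun j => z.2 i (val j)].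

Lemma zX_eqP (i : cell) (S : {set 'I_(K ch i)}) (z z' : Z) :
  zX S z = zX S z' <-> (forall j, j \in S -> z.2 i j = z'.2 i j).
Proof.
split=> [/ffunP e j jS|e]; last by apply/ffunP => -[j jS]; rewrite !ffunE e.
by have := e (exist _ j jS); rewrite !ffunE.
Qed.

(** U_{i'} is among the tested variables if it is wrong and among the conditioning ones otherwise; a
    correct U_i joins the conditioning. *)
Definition rho_num (i : cell) (S : {set 'I_(K ch i)}) (b : bool) (z : Z) :=
  (zX S z, opt b (z.1.2 (~~ i))).
Definition rho_cond (i : cell) (S : {set 'I_(K ch i)}) (p b : bool) (z : Z) :=
  (opt p (z.1.2 i), (zX (~: S) z, opt (~~ b) (z.1.2 (~~ i)), z.1.1)).

(* The likelihood ratio against which a candidate of error pattern [S], [p], [b]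
   is tested at receiver [i]; see [fval] for the meaning of [p] and [b]. *)
Definition rho (i : cell) (S : {set 'I_(K ch i)}) (p b : bool) (z : Z)
    (y : out ch i) : R :=
  zratio (rho_num S b) (rho_cond S p b) z y.

(** This lets receiver [i] run the test: of the other cell only the common layer enters. *)
Lemma rho_ext i (S : {set 'I_(K ch i)}) p b (z z' : Z) y :
  z.1 = z'.1 -> z.2 i = z'.2 i -> rho S p b z y = rho S p b z' y.
Proof.
move=> e1 e2; rewrite /rho /zratio.
have eX (S' : {set 'I_(K ch i)}) : zX S' z = zX S' z'.
  by apply/zX_eqP => j _; rewrite e2.
by rewrite /rho_num /rho_cond !eX e1.
Qed.

Let J_ge0 (w : Defs.space ch Q U) : 0 <= joint_law P w.
Proof. exact: (joint_law_ge0 pQ_pmf pUX_pmf pX_pmf PE). Qed.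

Lemma rho_ge0 i (S : {set 'I_(K ch i)}) p b z y : 0 <= rho S p b z y.
Proof. exact: cmi_ratio_ge0. Qed.

Lemma rho_gt0 i (S : {set 'I_(K ch i)}) p b v y :
  0 < pv vlaw v -> 0 < cell_law (ev v).2 y -> 0 < rho S p b (ev v) y.
Proof.
move=> v0 y0.
have pos (E : Z -> out ch i -> bool) : E (ev v) y ->
    0 < prob (joint_law P) (fun w : Defs.space ch Q U => E w.1 (w.2 i)).
  move=> Evy; have pv0 v' : 0 <= pv vlaw v' by apply: pv_ge0; exact: vlaw_ge0.
  have yge0 v' : 0 <= \sum_y cell_law (ev v').2 y * (E (ev v') y)%:R.
    by apply: sumr_ge0 => y' _; rewrite mulr_ge0 //; exact: (cell_law_pmf _ _).1.
  rewrite prob_joint_ev (bigD1 v) //= ltr_pwDl //; last first.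
    by apply: sumr_ge0 => v' _; exact: mulr_ge0 (pv0 v') (yge0 v').
  rewrite mulr_gt0 // (bigD1 y) //= Evy mulr1 ltr_pwDl //.
  by apply: sumr_ge0 => y' _; rewrite mulr_ge0 //; exact: (cell_law_pmf _ _).1.
rewrite /rho /zratio /cmi_ratio; set A := rho_num S b; set C := rho_cond S p b.
have := pos (fun z y' => [&& A z == A (ev v), y' == y & C z == C (ev v)]).
have := pos (fun z y' => C z == C (ev v)).
have := pos (fun z y' => (A z == A (ev v)) && (C z == C (ev v))).
have := pos (fun z y' => (y' == y) && (C z == C (ev v))).
rewrite !eqxx => /(_ isT) p1 /(_ isT) p2 /(_ isT) p3 /(_ isT) p4.
by apply: divr_gt0; apply: mulr_gt0.
Qed.

Lemma rho_mean i (S : {set 'I_(K ch i)}) (p b : bool) : (p -> user1 ch i \in S) ->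
  \sum_v \sum_y pv vlaw v * cell_law (ev v).2 y * log2 (rho S p b (ev v) y) =
  fval P S p b.
Proof.
move=> pS; transitivity (cond_mutual_info (joint_law P)
    (fun w : Defs.space ch Q U => rho_num S b w.1) (@rvY _ ch Q U i)
    (fun w => rho_cond S p b w.1)).
  rewrite cond_mutual_info_exp.
  rewrite (sum_joint_law P (i := i) (fun z y => log2 (rho S p b z y))).
  rewrite -(ev_law (fun z => \sum_y cell_law z.2 y * log2 (rho S p b z y))).
  apply: eq_bigr => v _; rewrite big_distrr /=.
  by apply: eq_bigr => y _; rewrite -mulrA.
rewrite cond_mutual_info_entropy // (fval_HY pQ_pmf pUX_pmf pX_pmf PE).
congr (_ - _).
transitivity (HY P i [set: 'I_(K ch i)]%SET p true); last first.
  by case: (p); rewrite ?(HY_setT pQ_pmf pUX_pmf pX_pmf PE).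
apply: cond_entropy_equiv => // w w'; split.
  case=> ex eu' ep ex' eu'' eq; congr (_, (_, _, _)) => //.
    by apply/(rvX_setT S); split.
  by case: (b) eu' eu'' => //= [[->]|_ [->]].
case=> ep /(rvX_setT S) [ex ex'] eu' eq.
by congr ((_, opt b _), (_, (_, opt (~~ b) _, _))).
Qed.

(** Here [T] is the set of virtual users of which the competing word has another index than the sent
    one; the hypotheses match it to the error pattern on cell [i] and on both common layers. *)
Lemma rho_wrong (T : pred vuser) i (S : {set 'I_(K ch i)}) (p b : bool) :
  (p -> user1 ch i \in S) -> T None = false ->
  T (vu i) = (user1 ch i \in S) && ~~ p -> T (vu (~~ i)) = b ->
  (forall j : 'I_(K ch i), T (vx j) = (j \in S)) ->
  \sum_v \sum_v' pv vlaw v * pv vlaw v' *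
    \sum_y cell_law (ev v).2 y * rho S p b (ev (mix T v v')) y <= 1.
Proof.
move=> pS T0 Tu Tu' Tx; apply: wrong_ratio_le1.
  move=> v v'; rewrite /rho_cond /ev /=; congr (_, (_, _, _)).
  - case: (p) pS Tu => //= /(_ isT) uS; rewrite uS /= => Tu.
    by rewrite !ffunE Tu T0.
  (* If i.1 is outside [S], its layer U_i is not resampled either, so X_{i.1} is kept. *)
  - apply/zX_eqP => j; rewrite finset.inE => jS /=; rewrite !ffunE T0 Tx (negbTE jS).
    congr (_ (_, _)); rewrite /vsub; case: eqP => // ej.
    by rewrite Tu -ej (negbTE jS).
  - by case: (b) Tu' => //= Tu'; rewrite !ffunE Tu' T0.
  - by rewrite !ffunE T0.
move=> v1 v2 v' [eu eX eu' eq]; rewrite /= in eq.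
congr (_, _).
  (* A fresh X_{i.1} is evaluated at a fresh U_i or, when [p] holds, at the kept U_i, which is part
     of the condition. *)
  apply/zX_eqP => j jS /=; rewrite !ffunE T0 Tx jS eq; congr (_ (_, _)).
  rewrite /vsub; case: eqP => // ej; rewrite Tu -ej jS /=.
  by case: (p) eu => //= -[]; rewrite !ffunE eq => ->.
by case: (b) Tu' => //= Tu'; rewrite !ffunE Tu' T0 eq.
Qed.

End Virtual.

(** * Error patterns *)

Section Sizes.
Context (R : realType) (n : nat).
Implicit Types x y : R.

Definition nat_ceil x : nat := (Num.truncn x + (x != (Num.truncn x)%:R))%N.

Lemma nat_ceil_itv x : 0 <= x -> x <= (nat_ceil x)%:R < x + 1.
Proof.
move=> x0; have /andP [lo hi] := truncn_itv x0; rewrite /nat_ceil natrD.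
have [e|ne] := eqVneq x (Num.truncn x)%:R; first by rewrite /= addr0 -e lexx ltrDl ltr01.
rewrite natr1 (ltW hi) /= -natr1 ltrD2r.
by rewrite lt_neqAle eq_sym ne.
Qed.

(* Bounds the number of wrong indices at rate [x]; at rate 0 there is none. *)
Definition pw x : R := if x == 0 then 0 else 2 `^ (n%:R * x).

Lemma pw_ge0 x : 0 <= pw x.
Proof. by rewrite /pw; case: ifP => // _; exact: powR_ge0. Qed.

Lemma powR2_ge1 x : 0 <= x -> 1 <= 2 `^ (n%:R * x) :> R.
Proof.
move=> x0; rewrite -[leLHS](powRr0 2); apply: ler_powR; first by rewrite ler1n.
by rewrite mulr_ge0.
Qed.

Lemma pwM x y : 0 <= x -> 0 <= y -> pw x * pw y <= pw (x + y).
Proof.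
move=> x0 y0; rewrite {1 2}/pw.
case: eqVneq => [_|nx]; first by rewrite mul0r pw_ge0.
case: eqVneq => [_|ny]; first by rewrite mulr0 pw_ge0.
rewrite -powRD; last by rewrite pnatr_eq0 implybT.
by rewrite /pw paddr_eq0 // (negbTE nx) mulrDr.
Qed.

(** Non-emptiness matters: the empty product is 1, while [pw] vanishes at 0. *)
Lemma prod_pw (I : finType) (A : {set I}) (f : I -> R) :
  A != finset.set0 -> (forall i, 0 <= f i) ->
  \prod_(i in A) pw (f i) <= pw (\sum_(i in A) f i).
Proof.
move=> /set0Pn [i0 Ai0] f0; rewrite (bigD1 i0) //=.
rewrite [\sum_(i in A) _](bigD1 i0) //=.
have H (r : seq I) (p : pred I) : forall x, 0 <= x ->
    pw x * \prod_(i <- r | p i) pw (f i) <= pw (x + \sum_(i <- r | p i) f i).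
  elim: r => [|i r IH] x x0; first by rewrite !big_nil mulr1 addr0.
  rewrite !big_cons; case: ifP => _; last exact: IH.
  rewrite mulrA addrA; apply: le_trans (IH _ (addr_ge0 x0 (f0 i))).
  by rewrite ler_wpM2r ?pwM // prodr_ge0 // => j _; exact: pw_ge0.
exact: H.
Qed.

Lemma nb_messages_gt0 x : 0 <= x -> (0 < nb_messages n x)%N.
Proof. by move=> x0; rewrite truncn_gt0 powR2_ge1. Qed.

Lemma nb_messages_le x : (nb_messages n x)%:R <= 2 `^ (n%:R * x) :> R.
Proof. by rewrite truncn_le powR_ge0. Qed.

Lemma nb_messages_pred x : 0 <= x -> (nb_messages n x).-1%:R <= pw x.
Proof.
move=> x0; rewrite /pw; case: eqVneq => [->|_].
  by rewrite /nb_messages mulr0 powRr0 truncn1.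
by apply: le_trans (nb_messages_le x); rewrite ler_nat leq_pred.
Qed.

(** Rounding up keeps the number of common parts small, and one less than the rounded value is still
    at most 2^(nx). *)
Definition nb_private x : nat := nat_ceil (2 `^ (n%:R * x)).

Lemma nb_private_ge x : 2 `^ (n%:R * x) <= (nb_private x)%:R :> R.
Proof. by have /andP [] := nat_ceil_itv (powR_ge0 2 (n%:R * x)). Qed.

Lemma nb_private_gt0 x : (0 < nb_private x)%N.
Proof.
by rewrite -(ltr_nat R); apply: lt_le_trans (nb_private_ge x); rewrite powR_gt0.
Qed.

Lemma nb_private_pred x : 0 <= x -> (nb_private x).-1%:R <= pw x.
Proof.
move=> x0; have /andP [lo hi] := nat_ceil_itv (powR_ge0 2 (n%:R * x)).
have p0 := nb_private_gt0 x; rewrite /pw; case: eqVneq => [e|_].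
  suff -> : (nb_private x).-1 = 0%N by [].
  apply/eqP; rewrite -leqn0 -ltnS prednK //.
  move: hi; rewrite -/(nb_private x) e mulr0 powRr0 -[1 + 1]/(2%:R) ltr_nat.
  by rewrite ltnS.
rewrite -(lerD2r 1) natr1 prednK //; exact: ltW.
Qed.

(** The quotient times 2^(n(x - t)) is at most 2^(nx). For t = 0 there are no more messages than
    private parts, so the quotient is 0 and no common part can be wrong. *)
Lemma nb_common_pred (x t : R) : 0 <= t <= x ->
  ((nb_messages n x).-1 %/ nb_private (x - t))%:R <= pw t.
Proof.
move=> /andP [t0 tx]; set M := nb_messages n x; set p := nb_private (x - t).
have M0 : (0 < M)%N by apply: nb_messages_gt0; lra.
have p0 : (0 < p)%N := nb_private_gt0 _.
have Mx : M.-1%:R <= 2 `^ (n%:R * x) :> R.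
  by apply: le_trans (nb_messages_le x); rewrite ler_nat leq_pred.
rewrite /pw; case: eqVneq => [te|_].
  rewrite divn_small // prednK // -(ler_nat R).
  by apply: le_trans (nb_messages_le x) _; have := nb_private_ge (x - t); rewrite -/p {1}te subr0.
have gp : 0 < 2 `^ (n%:R * (x - t)) :> R by rewrite powR_gt0.
rewrite -(ler_pM2r gp) -powRD; last by rewrite pnatr_eq0 implybT.
rewrite -mulrDr (addrC t) subrK; apply: le_trans Mx.
apply: le_trans (_ : (M.-1 %/ p)%:R * p%:R <= _).
  by rewrite ler_wpM2l // nb_private_ge.
by rewrite -natrM ler_nat leq_trunc_div.
Qed.

(** The exponential decay is weakened, by exp x >= 1 + x, to the order 1/n that Chebyshev's
    inequality gives anyway. *)
Lemma powR2N_le (eps : R) : (0 < n)%N -> 0 < eps ->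
  2 `^ (- (n%:R * eps)) <= (eps * ln 2)^-1 / n%:R :> R.
Proof.
move=> n0 e0; rewrite powRN -invfM lef_pV2 ?posrE ?powR_gt0 //; last first.
  by rewrite mulr_gt0 ?mulr_gt0 ?ln2_gt0 // ltr0n.
rewrite -[X in _ <= X]lnK ?posrE ?powR_gt0 // ln_powR.
have := expR_ge1Dx (n%:R * eps * ln 2); lra.
Qed.

End Sizes.

Lemma card_neq_le (M : nat) (a : 'I_M) : #|[pred x | x != a]| = M.-1.
Proof. by rewrite cardC1 card_ord. Qed.

(** Among numbers with the same quotient by [p] the remainder is injective, and it differs from that
    of [a]. *)
Lemma card_same_div_le (M p : nat) (a : 'I_M) : (0 < p)%N ->
  (#|[pred x : 'I_M | (x != a) && (x %/ p == a %/ p)]| <= p.-1)%N.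
Proof.
move=> p0; pose f (x : 'I_M) : 'I_p := Ordinal (ltn_pmod x p0).
rewrite -(@card_in_image _ _ f) => [|x y]; last first.
  rewrite !inE => /andP [_ /eqP ex] /andP [_ /eqP ey] /(congr1 val) /= e.
  by apply: val_inj; rewrite /= (divn_eq x p) (divn_eq y p) ex ey e.
rewrite -(card_neq_le (f a)); apply: subset_leq_card; apply/fintype.subsetP => z.
move=> /fintype.imageP [x]; rewrite !inE => /andP [xa /eqP ex] ->.
apply: contra xa => /eqP /(congr1 val) /= e; apply/eqP/val_inj.
by rewrite /= (divn_eq x p) (divn_eq a p) ex e.
Qed.

Section Code.
Context (R : realType) (ch : mac_ic_mac R) (n : nat) (r : rates ch) (t : cell -> R).
Hypothesis r_ge0 : nonneg_rates r.
Hypothesis t_itv : forall i, 0 <= t i <= rate r (user1 ch i).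

(* The common part of the message [k] of user [i.1] is [k %/ npriv i]. *)
Definition npriv (i : cell) : nat := nb_private n (rate r (user1 ch i) - t i).
Definition ncomm (i : cell) : nat :=
  ((nb_messages n (rate r (user1 ch i))).-1 %/ npriv i).+1.
Definition common (i : cell) (k : nat) : 'I_(ncomm i) := inord (k %/ npriv i).

Definition vindex (k : vuser ch) : finType :=
  match k with
  | None => unit
  | Some (existT i None) => 'I_(ncomm i)
  | Some (existT i (Some j)) => 'I_(nb_messages n (rate r j))
  end.

(** Common indices are given apart from the messages, since a candidate at a receiver specifies the
    common part of the other cell without its message. *)
Definition mkidx (cs : {dffun forall i : cell, 'I_(ncomm i)})
    (m : messages n r) : idx vindex :=
  [ffun k => match k return vindex k with
             | None => tt
             | Some (existT i None) => cs i
             | Some (existT i (Some j)) => m i j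
             end].

Definition commons (m : messages n r) : {dffun forall i : cell, 'I_(ncomm i)} :=
  [ffun i => common i (m i (user1 ch i))].

Definition widx (m : messages n r) : idx vindex := mkidx (commons m) m.

Definition cand (i : cell) : finType :=
  (cell_messages n r i * 'I_(ncomm (~~ i)))%type.

(** The messages of the other cell are filled in with the sent ones; by [rho_ext] the tests at
    receiver [i] do not see them. *)
Definition cand_idx i (m : messages n r) (x : cand i) : idx vindex :=
  mkidx (dpair (common i (x.1 (user1 ch i))) x.2) (dpair x.1 (m (~~ i))).

Definition pattern (i : cell) : finType := ({set 'I_(K ch i)} * bool * bool)%type.

(** Patterns in which only the common part of the other cell is wrong are excluded: they cause no
    error at receiver [i]. *)
Definition valid i (e : pattern i) : bool :=
  (e.1.1 != finset.set0) && (e.1.2 ==> (user1 ch i \in e.1.1)).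

Definition wrong i (m : messages n r) (x : cell_messages n r i) : {set 'I_(K ch i)} :=
  [set j | x j != m i j]%SET.

Definition pat i (m : messages n r) (x : cand i) : pattern i :=
  (wrong m x.1, (user1 ch i \in wrong m x.1) &&
     (common i (x.1 (user1 ch i)) == common i (m i (user1 ch i))),
   x.2 != common (~~ i) (m (~~ i) (user1 ch (~~ i)))).

Definition pat_rate i (e : pattern i) : R :=
  sum_rate r e.1.1 - e.1.2%:R * t i + e.2%:R * t (~~ i).

Lemma wrong_eq0 i (m : messages n r) (x : cell_messages n r i) : (wrong m x == finset.set0) = (x == m i).
Proof.
apply/eqP/eqP => [e|->]; last by apply/setP => j; rewrite !finset.inE eqxx.
apply/ffunP => j; apply/eqP; have := finset.in_set0 j; rewrite -e finset.inE.
by move/negbFE.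
Qed.

Lemma pat_valid i (m : messages n r) (x : cand i) : x.1 != m i -> valid (pat m x).
Proof.
by move=> ne; rewrite /valid /= wrong_eq0 ne; apply/implyP => /andP [].
Qed.

Lemma common_inj i (a b : 'I_(nb_messages n (rate r (user1 ch i)))) :
  common i a = common i b -> (a %/ npriv i = b %/ npriv i)%N.
Proof.
have lt (c : 'I_(nb_messages n (rate r (user1 ch i)))) : (c %/ npriv i < ncomm i)%N.
  have M0 : (0 < nb_messages n (rate r (user1 ch i)))%N.
    by apply: leq_ltn_trans (ltn_ord c).
  by rewrite ltnS leq_div2r // -ltnS prednK.
by move/(congr1 val); rewrite /= !inordK.
Qed.

(** The rate at which user [j] contributes wrong candidates: if the common part of i.1 is correct,
    only its private rate counts. *)
Let pr_rate i (p : bool) (j : 'I_(K ch i)) : R :=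
  rate r j - (p && (j == user1 ch i))%:R * t i.

Let pr_rate_ge0 i p (j : 'I_(K ch i)) : 0 <= pr_rate p j.
Proof.
rewrite /pr_rate; case: p => /=; last by rewrite mul0r subr0; exact: r_ge0.
case: eqP => [->|_]; last by rewrite mul0r subr0; exact: r_ge0.
by have /andP [_] := t_itv i; rewrite mul1r subr_ge0.
Qed.

Lemma pat_rateE i (e : pattern i) : valid e ->
  pat_rate e = \sum_(j in e.1.1) pr_rate e.1.2 j + e.2%:R * t (~~ i).
Proof.
case: e => [[S p] b] /andP [/= _ /implyP pS]; rewrite /pat_rate /=; congr (_ + _).
rewrite /pr_rate sumrB; congr (_ - _); rewrite -big_distrl /=; congr (_ * _).
case: p pS => /= [/(_ isT) uS|_]; last by rewrite big1.
by rewrite (bigD1 (user1 ch i)) //= ?eqxx big1 ?addr0 // => j /andP [_ /negbTE ->].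
Qed.

Lemma pat_rate_ge0 i (e : pattern i) : valid e -> 0 <= pat_rate e.
Proof.
move=> ve; rewrite pat_rateE //; apply: addr_ge0.
  by apply: sumr_ge0 => j _; exact: pr_rate_ge0.
by apply: mulr_ge0 => //; have /andP [] := t_itv (~~ i).
Qed.

Lemma sum_indicator_le (T : finType) (A : pred T) (f : T -> bool) :
  (forall x, f x -> A x) -> \sum_x (f x)%:R <= #|A|%:R :> R.
Proof.
move=> fA; rewrite -sum1_card natr_sum [leRHS]big_mkcond /=; apply: ler_sum => x _.
by case fx : (f x); [rewrite (fA _ fx : x \in A)|case: ifP].
Qed.

(** The condition on a candidate is relaxed to a product of conditions, one per user and one on the
    common index of the other cell, which are counted separately. *)
Lemma card_pat_le i (m : messages n r) (e : pattern i) : valid e ->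
  #|[pred x : cand i | pat m x == e]|%:R <= pw n (pat_rate e).
Proof.
move=> ve; rewrite pat_rateE //; move: ve; case: e => [[S p] b] /= /andP [/= Sn _].
pose c0 := common (~~ i) (m (~~ i) (user1 ch (~~ i))).
pose f j (a : 'I_(nb_messages n (rate r j))) : R :=
  (((a != m i j) == (j \in S)) &&
   ((p && (j == user1 ch i)) ==> (a %/ npriv i == m i j %/ npriv i)%N))%:R.
pose g (c : 'I_(ncomm (~~ i))) : R := ((c != c0) == b)%:R.
have le1 : #|[pred x : cand i | pat m x == (S, p, b)]|%:R <=
    (\prod_j \sum_a f j a) * \sum_c g c.
  rewrite -(big_dffun_distr f) big_distrlr /= pair_bigA /=.
  rewrite -sum1_card natr_sum big_mkcond /=; apply: ler_sum => -[x c] _.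
  rewrite inE; case: ifP => [/eqP [eS ep eb]|_]; last first.
    by rewrite mulr_ge0 // prodr_ge0.
  rewrite /g eb eqxx mulr1 big1 // => j _; rewrite /f.
  rewrite -eS finset.inE eqxx /=; suff -> : p && (j == user1 ch i) ==>
     (x j %/ npriv i == m i j %/ npriv i)%N by [].
  apply/implyP => /andP [pT /eqP ->]; move: ep; rewrite pT => /andP [_ /eqP].
  by move/common_inj => ->.
apply: le_trans le1 _.
have f_le j : \sum_a f j a <= if j \in S then pw n (pr_rate p j) else 1.
  rewrite /f; case: (boolP (j \in S)) => jS; last first.
    apply: le_trans (sum_indicator_le (A := pred1 (m i j)) _) _; last by rewrite card1.
    by move=> a /andP [/eqP/negbFE].
  rewrite /pr_rate; case: (boolP (p && _)) => [/andP [_ /eqP ej]|_] /=.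
    rewrite ej mul1r; apply: le_trans (sum_indicator_le (A :=
      [pred a | (a != m i (user1 ch i)) &&
                (a %/ npriv i == m i (user1 ch i) %/ npriv i)%N]) _) _.
      by move=> a /=; rewrite eqb_id.
    apply: (@le_trans _ _ (npriv i).-1%:R).
      by rewrite ler_nat card_same_div_le // nb_private_gt0.
    by apply: nb_private_pred; have /andP [_] := t_itv i; rewrite subr_ge0.
  rewrite mul0r subr0; apply: le_trans (sum_indicator_le (A :=
    [pred a | a != m i j]) _) _.
    by move=> a /=; rewrite eqb_id andbT.
  by rewrite card_neq_le nb_messages_pred.
have g_le : \sum_c g c <= if b then pw n (t (~~ i)) else 1.
  rewrite /g; case: b {g}.
    apply: le_trans (sum_indicator_le (A := [pred c | c != c0]) _) _.
      by move=> c; rewrite eqb_id.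
    by rewrite card_neq_le /=; apply: nb_common_pred.
  apply: le_trans (sum_indicator_le (A := pred1 c0) _) _; last by rewrite card1.
  by move=> c /eqP/negbFE.
have fprod : \prod_j \sum_a f j a <= pw n (\sum_(j in S) pr_rate p j).
  apply: le_trans (prod_pw n Sn (@pr_rate_ge0 i p)).
  rewrite [leRHS]big_mkcond /=; apply: ler_prod => j _.
  by rewrite f_le andbT sumr_ge0.
have g0 : 0 <= \sum_c g c by apply: sumr_ge0.
have f0 : 0 <= \prod_j \sum_a f j a by apply: prodr_ge0 => j _; apply: sumr_ge0.
apply: le_trans (ler_pM f0 g0 fprod g_le) _.
case: b {g g_le g0} => /=; last by rewrite mul0r addr0 mulr1.
rewrite mul1r; apply: pwM; first by apply: sumr_ge0 => j _; exact: pr_rate_ge0.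
by have /andP [] := t_itv (~~ i).
Qed.

End Code.

(** * Random coding *)

(** A union bound over the two receivers, after which the output block of the other receiver sums
    out. *)
Lemma error_prob_le (R : realType) (ch : mac_ic_mac R) (n : nat) (r : rates ch)
    (c : code n r) (m : messages n r) :
  \sum_(y : output_blocks ch n | [exists i : cell, dec c (y i) != m i])
      \prod_(s < n) channel_law (sent c m s) (received y s) <=
  \sum_(i : cell) \sum_(y : {ffun 'I_n -> out ch i} | dec c y != m i)
      \prod_(s < n) cell_law (sent c m s) (y s).
Proof.
pose L (y : output_blocks ch n) := \prod_(s < n) channel_law (sent c m s) (received y s).
have L0 y : 0 <= L y.
  by apply: prodr_ge0 => s _; apply: prodr_ge0 => i _; exact: (law_pmf _ _).1.
apply: (@le_trans _ _ (\sum_(i : cell) \sum_(y : output_blocks ch n | dec c (y i) != m i) L y)).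
  rewrite (eq_bigr (fun i => \sum_(y : output_blocks ch n) if dec c (y i) != m i then L y else 0)); last first.
    by move=> i _; rewrite big_mkcond.
  rewrite exchange_big big_mkcond /=; apply: ler_sum => y _.
  case: ifP => [/existsP [i ei]|_]; last by apply: sumr_ge0 => i _; case: ifP.
  by rewrite (bigD1 i) //= ei lerDl; apply: sumr_ge0 => j _; case: ifP.
apply: ler_sum => i _; rewrite big_mkcond (big_dpair i) [leRHS]big_mkcond /=.
apply: ler_sum => a _; rewrite (eq_bigr (fun b : {ffun 'I_n -> out ch (~~ i)} => if dec c a != m i then
  (\prod_(s < n) cell_law (sent c m s) (a s)) *
  \prod_(s < n) cell_law (i := ~~ i) (sent c m s) (b s) else 0)) => [|b _]; last first.
  rewrite dpairE1; case: ifP => // _; rewrite -big_split /=; apply: eq_bigr => s _.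
  have rE k : received (dpair a b) s k = (dpair a b : output_blocks ch n) k s.
    by rewrite ffunE.
  by rewrite /channel_law (big_cell _ i) /= !rE dpairE1 dpairE2.
case: ifP => _; last by rewrite big1.
rewrite -big_distrr /= -(bigA_distr_bigA (fun s y => cell_law (sent c m s) y)).
by rewrite [X in _ * X]big1 ?mulr1 // => s _; exact: (law_pmf _ _).2.
Qed.

Lemma union_bound (R : realType) (T E X : finType) (w : T -> R) (D : pred T)
    (V : pred E) (A : E -> pred T) (F : pred X) (B : X -> pred T) :
  (forall y, 0 <= w y) ->
  (forall y, D y -> (exists2 e, V e & A e y) \/ (exists2 x, F x & B x y)) ->
  \sum_(y | D y) w y <=
  \sum_(e | V e) \sum_(y | A e y) w y + \sum_(x | F x) \sum_(y | B x y) w y.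
Proof.
move=> w0 DAB.
rewrite (eq_bigr (fun e => \sum_y if A e y then w y else 0)); last first.
  by move=> e _; rewrite big_mkcond.
rewrite [X in _ + X](eq_bigr (fun x => \sum_y if B x y then w y else 0)); last first.
  by move=> e _; rewrite big_mkcond.
rewrite exchange_big [X in _ + X]exchange_big -big_split big_mkcond /=.
apply: ler_sum => y _.
case: ifP => [/DAB [[e Ve Ae]|[x Fx Bx]]|_].
- rewrite (bigD1 e) //= Ae -addrA lerDl.
  by apply: addr_ge0; apply: sumr_ge0 => ? _; case: ifP.
- rewrite [X in _ + X](bigD1 x) //= Bx addrCA lerDl.
  by apply: addr_ge0; apply: sumr_ge0 => ? _; case: ifP.
- by apply: addr_ge0; apply: sumr_ge0 => ? _; case: ifP.
Qed.

Lemma exists_le_mean (R : realType) (T : finType) (p f : T -> R) (c : R) :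
  is_pmf p -> \sum_b p b * f b <= c -> exists b, f b <= c.
Proof.
move=> [p0 p1] le; apply: contrapT => nex.
have gt b : c < f b by rewrite ltNge; apply/negP => h; apply: nex; exists b.
have [b pb] : exists b, 0 < p b.
  apply: contrapT => nb; have := p1; rewrite big1; first lra.
  move=> b _; apply/eqP; rewrite eq_le p0 andbT leNgt; apply/negP => h.
  by apply: nb; exists b.
have : \sum_b p b * c < \sum_b p b * f b.
  rewrite -subr_gt0 -sumrB (bigD1 b) //= ltr_pwDl ?subr_gt0 ?ltr_pM2l //.
  by apply: sumr_ge0 => b' _; rewrite subr_ge0 ler_wpM2l // ltW.
by rewrite -big_distrl /= p1 mul1r ltNge le.
Qed.

Section RandomCoding.
Context (R : realType) (ch : mac_ic_mac R) (Q : finType) (U : cell -> finType).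
Context (P : Q * aux U * inputs ch -> R).
Context (pQ : Q -> R) (pUX : forall i, Q -> U i * inp ch i (user1 ch i) -> R).
Context (pX : forall i (j : 'I_(K ch i)), Q -> inp ch i j -> R).
Arguments pUX : clear implicits.
Arguments pX : clear implicits.
Hypothesis pQ_pmf : is_pmf pQ.
Hypothesis pUX_pmf : forall i q, is_pmf (pUX i q).
Hypothesis pX_pmf : forall i j q, j != user1 ch i -> is_pmf (pX i j q).
Hypothesis PE : forall q u x, P (q, u, x) =
  pQ q * \prod_(i : cell) (pUX i q (u i, x i (user1 ch i)) *
                           \prod_(j | j != user1 ch i) pX i j q (x i j)).
Context (r : rates ch) (t : cell -> R).
Hypothesis r_ge0 : nonneg_rates r.
Hypothesis t_itv : forall i, 0 <= t i <= rate r (user1 ch i).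

Definition pval i (e : pattern ch i) : R := fval P e.1.1 e.1.2 e.2.

(** Half of the gap serves the test on the sent word, the other half the count of wrong candidates.
    At pattern rate 0 there are no such candidates, and any positive value would do. *)
Definition slack i (e : pattern ch i) : R :=
  if pat_rate r t e == 0 then 1 else (pval e - pat_rate r t e) / 2.

Hypothesis rate_lt : forall i (e : pattern ch i), valid e ->
  pat_rate r t e = 0 \/ pat_rate r t e < pval e.

Lemma slack_gt0 i (e : pattern ch i) : valid e -> 0 < slack e.
Proof.
move=> /rate_lt; rewrite /slack; case: eqVneq => // ne [e0|lt].
  by rewrite e0 eqxx in ne.
by rewrite divr_gt0 // subr_gt0.
Qed.

Let pk := vlaw pQ pUX pX.
Let pk1 := vlaw_sum1 pQ_pmf pUX_pmf pX_pmf.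
Let pk0 := vlaw_ge0 pQ_pmf pUX_pmf pX_pmf.
Let W i (v : vec (valph Q U)) (y : out ch i) : R := cell_law (ev v).2 y.
Let W_pmf i v : is_pmf (@W i v).
Proof. exact: cell_law_pmf. Qed.

Definition variance i (e : pattern ch i) : R :=
  \sum_v \sum_y pv pk v * W v y *
    (log2 (rho P e.1.1 e.1.2 e.2 (ev v) y) - pval e) ^+ 2.

Definition error_const : R := \sum_(i : cell) \sum_(e : pattern ch i | valid e)
  (variance e / slack e ^+ 2 + (slack e * ln 2)^-1).

Section Block.
Context (n : nat).
Hypothesis n_gt0 : (0 < n)%N.

Let bk : finType := book (valph Q U) (vindex n r t) n.

Definition passes i (e : pattern ch i) (b : bk) (w : idx (vindex n r t))
    (y : {ffun 'I_n -> out ch i}) : bool :=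
  2 `^ (n%:R * (pval e - slack e)) <=
  \prod_s rho P e.1.1 e.1.2 e.2 (ev (pick_word (b s) w)) (y s).

(** The search runs over tuples of both cells, but the part for the other cell is discarded, which
    makes its decoding non-unique; [m0] is the default if no tuple passes. *)
Definition decoder (m0 : messages n r) (b : bk) i (y : {ffun 'I_n -> out ch i}) :
    cell_messages n r i :=
  (odflt m0 [pick m' | [forall e : pattern ch i,
                         valid e ==> passes e b (widx t m') y]]) i.

Definition random_code (m0 : messages n r) (b : bk) : code n r :=
  Code (fun i j (k : 'I_(nb_messages n (rate r j))) s =>
    let q : Q := (b s None : {ffun unit -> Q}) tt in
    let u : U i := (b s (vu ch i) : {ffun 'I_(ncomm n r t i) -> {ffun Q -> U i}})
                     (common n r t i k) q in
    (b s (vx j) : {ffun 'I_(nb_messages n (rate r j)) ->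
                        {ffun Q * option (U i) -> inp ch i j}}) k (q, vsub j u))
  (decoder m0 b).

Lemma sent_random_code m0 b (m : messages n r) s :
  sent (random_code m0 b) m s = (ev (pick_word (b s) (widx t m))).2.
Proof.
apply/ffunP => i; apply/ffunP => j; rewrite /ev /= !ffunE /= !ffunE /=.
congr (_ (_, _)); rewrite /vsub; case: eqP => // ej; congr (Some (_ _)).
by rewrite ej.
Qed.

(** An accepted tuple has passed the tests for all the patterns, in particular the one for the
    pattern in which it actually differs from [m]. *)
Lemma decoder_error m0 b i (m : messages n r) y : decoder m0 b y != m i ->
  (exists2 e : pattern ch i, valid e & ~~ passes e b (widx t m) y) \/
  (exists2 x : cand n r t i, x.1 != m i & passes (pat m x) b (cand_idx m x) y).
Proof.
rewrite /decoder => ne.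
case: (boolP [forall e : pattern ch i, valid e ==> passes e b (widx t m) y]); last first.
  rewrite negb_forall => /existsP [e]; rewrite negb_imply => /andP [ve pe].
  by left; exists e.
move=> allm; right; move: ne; case: pickP => [m' allm' /= ne|/(_ m)]; last first.
  by rewrite allm.
pose x : cand n r t i := (m' i, common n r t (~~ i) (m' (~~ i) (user1 ch (~~ i)))).
exists x => //.
have /forallP/(_ (pat m x))/implyP/(_ (pat_valid (x := x) ne)) := allm'.
rewrite /passes; congr (_ <= _); apply: eq_bigr => s _; apply: rho_ext.
  rewrite /ev /= !ffunE /=; congr (_, _); apply/ffunP => k; rewrite !ffunE /= !ffunE.
  congr (_ _); have : k = i \/ k = ~~ i by case: (k) (i) => [] []; [left|right|right|left].
  by case=> ->; rewrite ?dpairE1 ?dpairE2.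
by apply/ffunP => j; rewrite /ev /= !ffunE /= !dpairE1 ffunE.
Qed.

Lemma true_bound i (m : messages n r) (e : pattern ch i) : valid e ->
  \sum_b book_law pk b *
    \sum_(y | ~~ passes e b (widx t m) y) block_law (@W i) b (widx t m) y <=
  (variance e / slack e ^+ 2) / n%:R.
Proof.
move=> ve; have s0 := slack_gt0 ve.
under eq_bigr do under eq_bigl do rewrite -ltNge.
have [/= _ /implyP pS] := andP ve.
have mE : pval e = \sum_v \sum_y pv pk v * W v y *
    log2 (rho P e.1.1 e.1.2 e.2 (ev v) y).
  by rewrite (rho_mean pQ_pmf pUX_pmf pX_pmf PE _ pS).
apply: le_trans (true_word_law pk1 pk0 (@W_pmf i) (widx t m)
  (rho := fun v y => rho P e.1.1 e.1.2 e.2 (ev v) y) n_gt0 s0 _ mE) _.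
  by move=> v y; exact: (rho_gt0 pQ_pmf pUX_pmf pX_pmf PE).
by rewrite /variance invfM mulrA mulrAC.
Qed.

Lemma wrong_bound i (m : messages n r) (x : cand n r t i) : x.1 != m i ->
  \sum_b book_law pk b *
    \sum_(y | passes (pat m x) b (cand_idx m x) y) block_law (@W i) b (widx t m) y <=
  2 `^ (- (n%:R * (pval (pat m x) - slack (pat m x)))).
Proof.
move=> ne; set e := pat m x.
apply: (@wrong_word_law _ _ _ _ _ pk1 pk0 _ _ (@W_pmf i) n (widx t m)
  (cand_idx m x) (fun v y => rho P e.1.1 e.1.2 e.2 (ev v) y)).
  by move=> v y; exact: (rho_ge0 pQ_pmf pUX_pmf pX_pmf PE).
apply: (rho_wrong pQ_pmf pUX_pmf pX_pmf PE).
- by move=> /andP [].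
- by rewrite !ffunE.
- rewrite !ffunE /= dpairE1 ffunE finset.inE eq_sym.
  have [->|_] := eqVneq (x.1 (user1 ch i)) (m i (user1 ch i)) => //=.
  by rewrite eqxx.
- by rewrite !ffunE /= dpairE2 ffunE eq_sym.
- by move=> j; rewrite !ffunE /= dpairE1 finset.inE eq_sym.
Qed.

(** Grouping by pattern, there are at most 2^(n rate) candidates, each of probability at most 2^(-n
    (pval - slack)); with the slack half of the gap the product is 2^(-n slack). *)
Lemma cand_bound i (m : messages n r) :
  \sum_(x : cand n r t i | x.1 != m i)
    2 `^ (- (n%:R * (pval (pat m x) - slack (pat m x)))) <=
  \sum_(e : pattern ch i | valid e) (slack e * ln 2)^-1 / n%:R :> R.
Proof.
rewrite (partition_big (@pat _ _ _ _ _ i m) (@valid _ ch i)) => [|x]; last exact: pat_valid.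
apply: ler_sum => e ve; have s0 := slack_gt0 ve.
apply: le_trans (powR2N_le n_gt0 s0).
apply: (@le_trans _ _ (\sum_(x : cand n r t i | pat m x == e)
    2 `^ (- (n%:R * (pval e - slack e))))).
  rewrite big_mkcond [leRHS]big_mkcond /=; apply: ler_sum => x _.
  case: ifP => [/andP [_ /eqP ->]|_]; first by rewrite eqxx.
  by case: ifP => // _; exact: powR_ge0.
have -> (c : R) : \sum_(x : cand n r t i | pat m x == e) c =
    #|[pred x : cand n r t i | pat m x == e]|%:R * c.
  by rewrite mulr_natl -sumr_const; apply: eq_bigl => x; rewrite inE.
apply: le_trans (ler_wpM2r (powR_ge0 _ _) (card_pat_le r_ge0 t_itv m ve)) _.
rewrite /pw; case: eqVneq => [_|ne]; first by rewrite mul0r powR_ge0.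
rewrite -powRD; last by rewrite pnatr_eq0 implybT.
apply: ler_powR; first by rewrite ler1n.
rewrite le_eqVlt /slack (negbTE ne); apply/orP; left; apply/eqP; by field.
Qed.

Lemma messages_inhabited : exists m0 : messages n r, true.
Proof.
have m0 i (j : 'I_(K ch i)) : 'I_(nb_messages n (rate r j)).
  have := nb_messages_gt0 n (r_ge0 j); case: (nb_messages _ _) => // k _.
  exact: ord0.
by exists [ffun i => [ffun j => m0 i j]].
Qed.

Lemma random_coding : exists c : code n r, error_prob c <= error_const / n%:R.
Proof.
have [m0 _] := messages_inhabited.
pose err b (m : messages n r) i := \sum_(y : {ffun 'I_n -> out ch i} | decoder m0 b y != m i)
  block_law (@W i) b (widx t m) y.
have errE b : error_prob (random_code m0 b) <=
    #|messages n r|%:R^-1 * \sum_(m : messages n r) \sum_(i : cell) err b m i.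
  rewrite /error_prob ler_wpM2l ?invr_ge0 //; apply: ler_sum => m _.
  apply: le_trans (error_prob_le _ _) _; apply: ler_sum => i _.
  rewrite le_eqVlt; apply/orP; left; apply/eqP; apply: eq_bigr => y _.
  by apply: eq_bigr => s _; rewrite sent_random_code.
have errm m i : \sum_b book_law pk b * err b m i <=
    \sum_(e : pattern ch i | valid e)
      (variance e / slack e ^+ 2 + (slack e * ln 2)^-1) / n%:R.
  apply: (@le_trans _ _ (\sum_b book_law pk b *
    (\sum_(e : pattern ch i | valid e) \sum_(y | ~~ passes e b (widx t m) y)
        block_law (@W i) b (widx t m) y +
     \sum_(x : cand n r t i | x.1 != m i)
       \sum_(y | passes (pat m x) b (cand_idx m x) y)
        block_law (@W i) b (widx t m) y))).
    apply: ler_sum => b _; apply: ler_wpM2l; first exact: book_law_ge0.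
    apply: union_bound => [y|y]; first exact: block_law_ge0.
    exact: decoder_error.
  under eq_bigr do rewrite mulrDr.
  rewrite big_split /=; under [leRHS]eq_bigr do rewrite mulrDl.
  rewrite [leRHS]big_split /=; apply: lerD.
    under eq_bigr do rewrite big_distrr /=.
    rewrite exchange_big /=; apply: ler_sum => e ve; exact: true_bound.
  apply: le_trans (@cand_bound i m).
  under eq_bigr do rewrite big_distrr /=.
  rewrite exchange_big /=; apply: ler_sum => x xm; exact: wrong_bound.
have M0 : 0 < #|messages n r|%:R :> R by rewrite ltr0n; apply/card_gt0P; exists m0.
(* Derandomization: some codebook does no worse than the average. *)
have [b hb] : exists b, error_prob (random_code m0 b) <= error_const / n%:R.
  apply: (@exists_le_mean _ bk (book_law pk (n := n))
    (fun b => error_prob (random_code m0 b))).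
    by split; [exact: book_law_ge0|exact: sum_book_law].
  apply: (@le_trans _ _ (\sum_b book_law pk b * (#|messages n r|%:R^-1 *
      \sum_(m : messages n r) \sum_(i : cell) err b m i))).
    by apply: ler_sum => b _; apply: ler_wpM2l; [exact: book_law_ge0|].
  under eq_bigr do rewrite mulrCA.
  rewrite -big_distrr /= mulrC ler_pdivrMr //.
  under eq_bigr do rewrite big_distrr /=.
  rewrite exchange_big /= -sum1_card natr_sum big_distrr /=.
  apply: ler_sum => m _; rewrite mulr1.
  under eq_bigr do rewrite big_distrr /=.
  rewrite exchange_big /error_const big_distrl /=; apply: ler_sum => i _.
  by rewrite big_distrl /=.
by exists (random_code m0 b).
Qed.

End Block.

Lemma error_prob_ge0 n (c : code n r) : 0 <= error_prob c.
Proof.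
rewrite mulr_ge0 ?invr_ge0 //; apply: sumr_ge0 => m _; apply: sumr_ge0 => y _.
by apply: prodr_ge0 => s _; apply: prodr_ge0 => i _; exact: (law_pmf _ _).1.
Qed.

Lemma achievable_of_rate_lt : achievable r.
Proof.
split=> //.
have h n : {c : code n r | (0 < n)%N -> error_prob c <= error_const / n%:R}.
  (* At block length 0 nothing is claimed about the error, so any code will do. *)
  apply: cid; case: n => [|n]; last by have [c hc] := random_coding (ltn0Sn n); exists c.
  have [m0 _] := messages_inhabited 0.
  by exists (Code (fun i j _ (s : 'I_0) => match notF (ltn_ord s) with end)
                  (fun i _ => m0 i)).
exists (fun n => sval (h n)).
(* The factor 2 comes from 1/n <= 2/(n + 1), as the harmonic sequence is indexed from 1/1. *)
apply: (@squeeze_cvgr _ _ _ _ (fun=> 0) (fun n => (`|error_const| * 2) * (n.+1%:R)^-1)).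
- near=> n; rewrite error_prob_ge0 /=.
  have n0 : (0 < n)%N by near: n; exact: nbhs_infty_gt.
  apply: le_trans (svalP (h n) n0) _.
  apply: (@le_trans _ _ (`|error_const| / n%:R)).
    by rewrite ler_wpM2r ?invr_ge0 // ler_norm.
  rewrite -mulrA ler_wpM2l // ler_pdivlMr ?ltr0n // mulrC ler_pdivrMr ?ltr0n //.
  by rewrite -natrM ler_nat mul2n -addnn -addn1 leq_add2l.
- exact: cvg_cst.
- rewrite -[X in _ --> X](mulr0 (`|error_const| * 2)).
  by apply: cvgM; [exact: cvg_cst|exact: cvg_harmonic].
Unshelve. all: by end_near.
Qed.

End RandomCoding.

(** * Approximation of a rate tuple by its multiples *)

Section Scaling.
Context (R : realType) (ch : mac_ic_mac R).

Definition scale_rates (a : R) (r : rates ch) : rates ch := (a *: r.1, a *: r.2).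

Lemma rate_scale a r i (j : 'I_(K ch i)) : rate (scale_rates a r) j = a * rate r j.
Proof. by case: i j => j; rewrite /rate mxE. Qed.

Lemma sum_rate_scale a r i (S : {set 'I_(K ch i)}) :
  sum_rate (scale_rates a r) S = a * sum_rate r S.
Proof. by rewrite /sum_rate big_distrr; apply: eq_bigr => j _; rewrite rate_scale. Qed.

Lemma near_scaling m n (M : 'M[R]_(m, n)) (B : set 'M[R]_(m, n)) :
  nbhs M B -> \forall d \near (0 : R)^'+, B ((1 - d) *: M).
Proof.
move=> [P nP sP].
have : \forall d \near (0 : R)^'+, forall i j, P i j (((1 - d) *: M) i j).
  apply: filter_forall => i; apply: filter_forall => j.
  suff cM : (((1 - d) *: M) i j) @[d --> (0 : R)^'+] --> M i j by exact: cM (nP i j).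
  have c1 : (1 - d : R) @[d --> (0 : R)^'+] --> (1 - 0 : R).
    by apply: cvgB; [exact: cvg_cst|exact/cvg_at_right_filter/cvg_id].
  under eq_fun do rewrite mxE.
  have := cvgM c1 (cvg_cst (M i j)); rewrite subr0 mul1r; exact.
by apply: filterS => d; exact: sP.
Qed.

Lemma closure_of_scaling (A : set ('rV[R]_(K ch cell1) * 'rV[R]_(K ch cell2)))
    (r : rates ch) :
  (forall d, 0 < d < 1 -> A (scale_rates (1 - d) r)) -> closure A r.
Proof.
move=> hA B [[B1 B2] /= [n1 n2] sB].
have near_B : \forall d \near (0 : R)^'+, B (scale_rates (1 - d) r).
  apply: filterS (filterI (near_scaling n1) (near_scaling n2)) => d [b1 b2].
  exact: sB.
have near_01 : \forall d \near (0 : R)^'+, 0 < d < 1.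
  near=> d; apply/andP; split; near: d; first exact: nbhs_right_gt.
  exact: nbhs_right_lt.
have [d [Bd d01]] := filter_ex (filterI near_B near_01).
by exists (scale_rates (1 - d) r); split=> //; exact: hA.
Unshelve. all: by end_near.
Qed.

End Scaling.

(** Scaling rates and common rates by 1 - d makes every constraint of positive pattern rate strict,
    and leaves pattern rate 0 at 0; these are the two cases that [rate_lt] admits. *)
Lemma Rin_achievable (R : realType) (ch : mac_ic_mac R) (r : rates ch) (d : R) :
  Rin ch r -> 0 < d < 1 -> achievable (scale_rates (1 - d) r).
Proof.
move=> [Q [U [P [[pQ [pUX [pX [hQ hUX hX PE]]]] hr]]]] /andP [d0 d1].
have r0 : nonneg_rates r by case: hr.
have [t [t_itv ht]] := rate_splitting hQ hUX hX PE hr.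
have a0 : 0 < 1 - d by rewrite subr_gt0.
apply: (@achievable_of_rate_lt _ _ _ _ _ _ _ _ hQ hUX hX PE _ (fun i => (1 - d) * t i)).
- by move=> i j; rewrite rate_scale mulr_ge0 // ltW.
- move=> i; rewrite rate_scale; have /andP [t0 t1] := t_itv i.
  by rewrite mulr_ge0 ?(ltW a0) //= ler_pM2l.
move=> i e ve; have pr0 := pat_rate_ge0 r0 t_itv ve.
have -> : pat_rate (scale_rates (1 - d) r) (fun i => (1 - d) * t i) e =
    (1 - d) * pat_rate r t e.
  by rewrite /pat_rate sum_rate_scale; ring.
have le : pat_rate r t e <= pval P e.
  by have /andP [Sn /implyP pS] := ve; exact: ht.
move: pr0; rewrite le_eqVlt => /predU1P [<-|pr0]; first by left; rewrite mulr0.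
by right; apply: lt_le_trans le; rewrite gtr_pMl // ltrBlDr ltrDl.
Qed.

Theorem theorem2 (R : realType) (ch : mac_ic_mac R) :
  Rc ch = Rin ch /\ Rin ch `<=` capacity_region ch.
Proof.
split; last first.
  by move=> r rin; apply: closure_of_scaling => d; exact: Rin_achievable.
apply/seteqP; split=> [r [Q [U [P [cP rP]]]]|r [Q [U [P [cP rP]]]]].
  exact: Rc_of_Rin cP rP.
by exists Q, U, P; split=> //; have /Rin_ofP [] := rP.
Qed.
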